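(* Let $X_i=\theta_i+\varepsilon_i$, $i=1,\dots,n$, with $\varepsilon_i$ i.i.d. $N(0,1)$. Assume that as $n\to\infty$, $s_n\to\infty$, $n/s_n\to\infty$, $\alpha_n\to0$ and $\log(1/\alpha_n)=o\{\sqrt{\log(n/s_n)}\}$. Fix a heterogeneous signal-strength vector $a=(a_1,\dots,a_{s_n})$ of positive numbers (for each $n$). Then the GBS procedure $\varphi^{\mathrm{GBS}}$ at nominal level $\alpha_n$ satisfies $$\sup_{\theta\in\Theta(a,s_n)}\frac1{s_n}\mathbb E_\theta\{V(\theta,\varphi^{\mathrm{GBS}})+T(\theta,\varphi^{\mathrm{GBS}})\}\le\Lambda_n(a)+o(1).$$
   Context: Here $(s_n)$ is a sequence of positive integers with $s_n\le n$ and $\alpha_n\in(0,1)$. The vector $a$ may depend on $n$. $\Phi$ is the standard normal distribution function and $\bar\Phi=1-\Phi$. For $\theta\in\mathbb R^n$, $S_\theta=\{i:\theta_i\ne0\}$. Define $$\Theta(a,s_n)=\{\theta\in\mathbb R^n:|S_\theta|=s_n,\ \text{there exist distinct } i_1,\dots,i_{s_n}\text{ such that }|\theta_{i_j}|\ge a_j,\ 1\le j\le s_n\},$$ $$a_n^*=\sqrt{2\log(n/s_n)},\qquad \Lambda_n(a)=\frac1{s_n}\sum_{j=1}^{s_n}\bar\Phi(a_j-a_n^* ).$$ One tests $H_{0i}:\theta_i=0$ versus $H_{1i}:\theta_i\ne0$. A multiple testing procedure is a function $\varphi=(\varphi_1,\dots,\varphi_n)\in\{0,1\}^n$ of the data,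 with $\varphi_i=1$ meaning that $H_{0i}$ is rejected. Put $V(\theta,\varphi)=\sum_{i:\theta_i=0}\varphi_i$ and $T(\theta,\varphi)=\sum_{i:\theta_i\ne0}(1-\varphi_i)$. GBS (Gavrilov--Benjamini--Sarkar) step-down procedure: let $P_i=2\bar\Phi(|X_i|)$, with ordered values $P_{(1)}\le\dots\le P_{(n)}$, and $c_j=\dfrac{j\alpha_n}{n+1-j(1-\alpha_n)}$, $j=1,\dots,n$. Let $R_n^{\mathrm{GBS}}=\max\{r:P_{(j)}\le c_j\text{ for every }1\le j\le r\}$ ($=0$ if the set is empty). $\varphi^{\mathrm{GBS}}$ rejects exactly the hypotheses corresponding to $P_{(1)},\dots,P_{(R_n^{\mathrm{GBS}})}$. *)

(* Defs.v *)
From HB Require Import structures.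
From mathcomp Require Import all_boot all_order all_algebra.
From mathcomp Require Import all_classical all_reals all_analysis.

Set Implicit Arguments.
Unset Strict Implicit.
Unset Printing Implicit Defensive.

Import Order.TTheory GRing.Theory Num.Theory.
Import numFieldNormedType.Exports.

Local Open Scope classical_set_scope.
Local Open Scope ring_scope.

Definition mutually_independent {d : measure_display} {T : measurableType d}
    {R : realType} (P : probability T R) {I : finType}
    (Y : I -> {RV P >-> R}) : Prop :=
  forall (J : {set I}) (B : I -> set R), (forall i, measurable (B i)) ->
    P (\bigcap_(i in [set` J]) (Y i @^-1` B i)) =
    (\prod_(i in J) P (Y i @^-1` B i))%E.

Definition iid_std_normal {d : measure_display} {T : measurableType d}
    {R : realType} (P : probability T R) {I : finType}
    (Y : I -> {RV P >-> R}) : Prop :=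
  mutually_independent Y /\
  forall i (B : set R), measurable B ->
    distribution P (Y i) B = normal_prob 0 1 B.

Definition Phi {R : realType} (x : R) : R :=
  fine (normal_prob 0 1 `]-oo, x]).

Definition barPhi {R : realType} (x : R) : R := 1 - Phi x.

Definition supp {R : realType} {n : nat} (theta : 'rV[R]_n) : {set 'I_n} :=
  [set i | theta 0 i != 0]%SET.

(* The entry [a_j], [1 <= j <= s], of the signal-strength vector is
   [a 0 (j - 1)]; [i] lists the distinct coordinates [i_1, .., i_s]. *)
Definition Theta {R : realType} (n s : nat) (a : 'rV[R]_s) : set 'rV[R]_n :=
  [set theta | #|supp theta| = s /\
     exists2 i : 'I_s -> 'I_n, injective i &
       forall j, a 0 j <= `|theta 0 (i j)|].

Arguments Theta {R} n {s} a _.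

Definition astar {R : realType} (n s : nat) : R :=
  Num.sqrt (2 * ln (n%:R / s%:R)).

Definition Lambda {R : realType} (n s : nat) (a : 'rV[R]_s) : R :=
  s%:R^-1 * \sum_(j < s) barPhi (a 0 j - astar n s).

(* A multiple testing procedure: [phi x i] holds iff [H_{0i}] is rejected on
   the data [x]. *)
Definition procedure (R : realType) (n : nat) : Type :=
  'rV[R]_n -> {ffun 'I_n -> bool}.

Definition V {R : realType} {n : nat} (theta : 'rV[R]_n)
    (phi : {ffun 'I_n -> bool}) : nat :=
  (\sum_(i < n | (theta 0 i == 0)%R) phi i)%N.

Definition T {R : realType} {n : nat} (theta : 'rV[R]_n)
    (phi : {ffun 'I_n -> bool}) : nat :=
  (\sum_(i < n | (theta 0 i != 0)%R) (1 - phi i))%N.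

Definition pval {R : realType} {n : nat} (x : 'rV[R]_n) (i : 'I_n) : R :=
  2 * barPhi `|x 0 i|.

Definition sorted_pvals {R : realType} {n : nat} (x : 'rV[R]_n) : seq R :=
  sort <=%R [seq pval x i | i : 'I_n].

(* [P_(j)], with [j] starting from 1. *)
Definition ordered_pval {R : realType} {n : nat} (x : 'rV[R]_n) (j : nat) : R :=
  nth 0 (sorted_pvals x) j.-1.

Definition gbs_crit {R : realType} (n : nat) (alpha : R) (j : nat) : R :=
  j%:R * alpha / (n%:R + 1 - j%:R * (1 - alpha)).

(* The value [r = 0] satisfies the condition vacuously, so it is the maximum
   exactly when no [r >= 1] qualifies. *)
Definition gbs_R {R : realType} {n : nat} (alpha : R) (x : 'rV[R]_n) : nat :=
  \max_(r < n.+1 | [forall j : 'I_n.+1,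
      (0 < j <= r)%N ==> (ordered_pval x j <= gbs_crit n alpha j)]) r.

(* For [0 < alpha < 1] the critical values increase with [j], so [P_(r)] and
   [P_(r+1)] are never tied at [r = gbs_R alpha x]: membership among the
   values [P_(1), .., P_(r)] selects exactly [r] hypotheses. *)
Definition gbs {R : realType} {n : nat} (alpha : R) : procedure R n :=
  fun x => [ffun i => pval x i \in take (gbs_R alpha x) (sorted_pvals x)].

(* The normalised expected number of errors
   [s^-1 E_theta (V(theta, phi) + T(theta, phi))] for the data
   [X = theta + eps]. *)
Definition risk {R : realType} {d : measure_display} {Omega : measurableType d}
    (P : probability Omega R) {n : nat} (eps : 'I_n -> {RV P >-> R})
    (s : nat) (phi : procedure R n) (theta : 'rV[R]_n) : \bar R :=
  ((s%:R^-1)%:E *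
   'E_P[fun w => let X := (\row_i (theta 0 i + eps i w))%R in
                 ((V theta (phi X) + T theta (phi X))%N)%:R])%E.

(* Main.v *)
Require Import Defs.
From HB Require Import structures.
From mathcomp Require Import all_boot all_order all_algebra.
From mathcomp Require Import all_classical all_reals all_analysis.
From mathcomp Require Import measurable_realfun.
From mathcomp Require Import ring lra zify.

(** The errors split into false rejections, which turn out to be negligible
    after division by [s], and missed signals, which produce [Lambda].

    _Discretisation._  The procedure only depends on the position of each
    p-value among the critical values [c_1 <= .. <= c_n].  Recording this
    position as a cell [z_i] in [{0, .., n}], with [P_i <= c_j] iff [z_i < j],
    turns the procedure into a purely combinatorial map [stepdown], where
    hypothesis [i] is rejected iff [z_i <= stepdown z].  The cells are
    independent, so every expectation becomes a finite sum against product
    weights ([expectation_cells]).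

    _False rejections_ ([expected_false_rejections]).  Let [K_i] be the number
    of rejections when hypothesis [i] is forced to be accepted.  Then [i] is
    rejected iff [z_i <= K_i], and if it is accepted then [K_i] is the actual
    number of rejections [R]; moreover [K_i] is independent of [z_i].  As null
    p-values are superuniform and the odds of [c_(k+1)] are
    [(k+1) alpha / (n-k)], the expected number of rejected nulls is at most the
    expectation of [(R+1) alpha / (n-R)] times the number of accepted nulls.
    The latter is at most [n - R], so [E V <= alpha E(R+1)
    <= alpha (E V + s + 1)], that is [E V <= alpha (s+1) / (1-alpha)].

    _Missed signals_ ([expected_T_le]).  Fix [delta].  If
    [Lambda > 1 - delta] the trivial bound [T <= s] is enough.  Otherwise at
    least [delta s / 2] signals have strength at least [astar - K] for a
    constant [K].  The event [P_i <= c_j] holds as soon as [|X_i| >= astar + y_j]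
    with [y_j^2 / 2 + astar y_j = log (4 s / (j alpha))]
    ([detection_threshold]), and the condition
    [log (1/alpha) = o(sqrt (log (n/s)))] makes the chance of a strong signal
    to pass it much larger than [j/s], uniformly for [j] up to a small multiple
    of [s] ([detection_power]).  A Chernoff bound and a union bound over [j]
    ([early_stop_le]) show that the procedure makes at least [k], of the order
    of [s], rejections with probability at least [1 - delta].  It then uses a
    level at least [c_k], whose threshold is [astar + o(1)]; since the normal
    tail is Lipschitz, a signal of strength [a_j] is missed with probability at
    most [barPhi (a_j - astar) + o(1)], and these sum to [s (Lambda + o(1))]. *)

Set Implicit Arguments.
Unset Strict Implicit.
Unset Printing Implicit Defensive.

Import Order.TTheory GRing.Theory Num.Theory.
Import numFieldNormedType.Exports.

Local Open Scope ring_scope.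

(** * Step-down procedures on cells *)

Section StepDown.
Local Open Scope nat_scope.
Variable n : nat.
Implicit Types (z : {ffun 'I_n -> 'I_n.+1}) (i : 'I_n).

Definition card_below z (j : nat) : nat := #|[set i | z i < j]|.

(** With [z i] the number of critical values below the [i]-th p-value,
    [card_below z j] is the number of p-values at most [c_j], so that
    [P_(j) <= c_j] reads [j <= card_below z j]. *)
Definition stepdown z : nat :=
  \max_(r < n.+1 | [forall j : 'I_n.+1, (0 < j <= r) ==> (j <= card_below z j)]) r.

Lemma stepdown_le z : stepdown z <= n.
Proof. by apply/bigmax_leqP => r _; rewrite -ltnS. Qed.

Lemma stepdownP z j : 0 < j <= stepdown z -> j <= card_below z j.
Proof.
move=> /andP[j0 jR].
have [|r /forallP Hr E] := @eq_bigmax_cond _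
    [pred r : 'I_n.+1 | [forall j : 'I_n.+1, (0 < j <= r) ==> (j <= card_below z j)]]
    (fun r => r : nat).
  apply/card_gt0P; exists ord0; rewrite inE; apply/forallP => k.
  by rewrite /= leqn0 lt0n andNb.
have jr : j <= r by rewrite -E.
have jn : j < n.+1 by apply: leq_ltn_trans (ltn_ord r).
by have /implyP := Hr (Ordinal jn); apply => /=; rewrite j0.
Qed.

Lemma stepdown_ge z r : r <= n ->
  (forall j, 0 < j <= r -> j <= card_below z j) -> r <= stepdown z.
Proof.
rewrite -ltnS => rn Hr.
apply: (@leq_bigmax_cond _ _ (fun r : 'I_n.+1 => r : nat) (Ordinal rn)).
by apply/forallP => j; apply/implyP => /Hr.
Qed.

Lemma stepdown_fail z : stepdown z < n ->
  card_below z (stepdown z).+1 <= stepdown z.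
Proof.
move=> Rn; rewrite leqNgt; apply/negP => H.
suff : stepdown z < stepdown z by rewrite ltnn.
apply: stepdown_ge => // j /andP[j0]; rewrite leq_eqVlt => /orP[/eqP -> //|].
by rewrite ltnS => jR; apply: stepdownP; rewrite j0.
Qed.

Lemma card_below_mono z j k : j <= k -> card_below z j <= card_below z k.
Proof.
move=> jk; apply/subset_leq_card/fintype.subsetP => i; rewrite !inE => /leq_trans.
exact.
Qed.

(** Stopping at [r < n] means that at most [r] p-values lie below [c_(r+1)],
    while at least [r] lie below [c_r]: nothing lies in between, so rejecting
    below [c_(r+1)] is the same as rejecting the [r] smallest p-values. *)
Lemma card_rejected z : #|[set i | z i <= stepdown z]| = stepdown z.
Proof.
have -> : [set i | z i <= stepdown z] = [set i | z i < (stepdown z).+1] by [].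
rewrite -/(card_below z _).
have [nR|Rn] := leqP n (stepdown z).
  have -> : stepdown z = n by apply/anti_leq; rewrite stepdown_le.
  apply/eqP; rewrite eqn_leq; apply/andP; split.
    by rewrite /card_below -[X in _ <= X]card_ord max_card.
  apply: leq_trans (card_below_mono z (leqnSn n)).
  case: (posnP n) => [->//|n0]; apply: stepdownP.
  by rewrite n0.
apply/eqP; rewrite eqn_leq stepdown_fail//=.
case: (posnP (stepdown z)) => [->//|R0].
apply: leq_trans (card_below_mono z (leqnSn _)).
by apply: stepdownP; rewrite R0 leqnn.
Qed.

Definition upd z i (v : 'I_n.+1) : {ffun 'I_n -> 'I_n.+1} :=
  [ffun k => if k == i then v else z k].

Lemma updK z i v v' : upd (upd z i v) i v' = upd z i v'.
Proof. by apply/ffunP => k; rewrite !ffunE; case: eqP. Qed.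

Lemma upd_id z i : upd z i (z i) = z.
Proof. by apply/ffunP => k; rewrite !ffunE; case: eqP => // ->. Qed.

Lemma upd_at z i v : upd z i v i = v.
Proof. by rewrite ffunE eqxx. Qed.

(** The cell [n] lies above every critical value, so putting [z i] there
    amounts to running the procedure without the [i]-th p-value while keeping
    the critical values. *)
Definition stepdown_without z i : nat := stepdown (upd z i ord_max).

Lemma stepdown_without_upd z i v : stepdown_without (upd z i v) i = stepdown_without z i.
Proof. by rewrite /stepdown_without updK. Qed.

Lemma card_below_upd z i j : j <= n ->
  card_below z j = (z i < j) + card_below (upd z i ord_max) j.
Proof.
move=> jn; rewrite /card_below (cardsD1 i) inE; congr (_ + _).
apply: eq_card => k; rewrite !inE ffunE; case: eqP => //= _.
by rewrite ltnNge jn.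
Qed.

Lemma stepdown_without_lt z i : stepdown_without z i < n.
Proof.
rewrite ltn_neqAle stepdown_le andbT; apply/negP => /eqP E.
have n0 : 0 < n by apply: leq_ltn_trans (ltn_ord i).
have := @stepdownP (upd z i ord_max) n; rewrite -/(stepdown_without z i).
rewrite E n0 leqnn => /(_ isT).
rewrite leqNgt => /negP; apply.
rewrite /card_below -[X in _ < X]card_ord -cardsT; apply: proper_card.
rewrite properT; apply/negP => /eqP /setP /(_ i).
by rewrite !inE upd_at ltnn.
Qed.

Lemma stepdown_without_le z i : stepdown_without z i <= stepdown z.
Proof.
apply: stepdown_ge; first exact: stepdown_le.
move=> j jK; have := stepdownP jK; case/andP: jK => _ jK.
rewrite (@card_below_upd z i) => [H|]; last exact: leq_trans jK (stepdown_le _).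
exact: leq_trans H (leq_addl _ _).
Qed.

(** A p-value above the level at which the run without it stops does not help
    to pass that level. *)
Lemma stepdown_without_accepted z i : stepdown_without z i < z i ->
  stepdown z = stepdown_without z i.
Proof.
move=> zK; apply/eqP; rewrite eqn_leq stepdown_without_le andbT leqNgt; apply/negP => KR.
have := @stepdownP z (stepdown_without z i).+1 KR.
have /stepdown_fail := stepdown_without_lt z i; rewrite -/(stepdown_without z i).
rewrite (@card_below_upd z i) ?stepdown_without_lt// (ltnNge (z i)) zK /= add0n => H1 H2.
by have := leq_trans H2 H1; rewrite ltnn.
Qed.

Lemma rejected_without z i : (z i <= stepdown z) = (z i <= stepdown_without z i).
Proof.
have [zK|zK] := leqP (z i) (stepdown_without z i).
  exact: leq_trans (stepdown_without_le z i).
by apply/negbTE; rewrite -ltnNge (stepdown_without_accepted zK).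
Qed.

End StepDown.

(** * Independent cells and the expected number of false rejections *)

Section ProductWeights.
Variables (R : realFieldType) (n : nat) (w : 'I_n -> 'I_n.+1 -> R).
Hypothesis w_ge0 : forall i v, 0 <= w i v.
Hypothesis w_sum : forall i, \sum_v w i v = 1.
Implicit Types (z : {ffun 'I_n -> 'I_n.+1}) (i : 'I_n).

Definition pweight z : R := \prod_i w i (z i).

Definition pexp (f : {ffun 'I_n -> 'I_n.+1} -> R) : R := \sum_z pweight z * f z.

Lemma pweight_ge0 z : 0 <= pweight z. Proof. exact: prodr_ge0. Qed.

Lemma pexp_prod (f : 'I_n -> 'I_n.+1 -> R) :
  pexp (fun z => \prod_i f i (z i)) = \prod_i \sum_v w i v * f i v.
Proof.
rewrite bigA_distr_bigA; apply: eq_bigr => z _.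
by rewrite /pweight -big_split.
Qed.

Lemma pexp_le f g : (forall z, f z <= g z) -> pexp f <= pexp g.
Proof. by move=> fg; apply: ler_sum => z _; rewrite ler_wpM2l ?pweight_ge0. Qed.

Lemma pexp_cst c : pexp (fun=> c) = c.
Proof.
rewrite /pexp -mulr_suml.
suff -> : \sum_z pweight z = 1 by rewrite mul1r.
have -> : \sum_z pweight z = pexp (fun z => \prod_i (fun _ _ => 1) i (z i)).
  by apply: eq_bigr => z _; rewrite /= [X in _ * X]big1 ?mulr1.
rewrite (pexp_prod (fun _ _ => 1)) big1 // => i _.
by rewrite -[RHS](w_sum i); apply: eq_bigr => v _; rewrite mulr1.
Qed.

Lemma pexp_sum (I : Type) (r : seq I) (Q : pred I) f :
  pexp (fun z => \sum_(k <- r | Q k) f k z) = \sum_(k <- r | Q k) pexp (f k).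
Proof.
rewrite /pexp exchange_big; apply: eq_bigr => z _; by rewrite mulr_sumr.
Qed.

Lemma pexpD f g : pexp (fun z => f z + g z) = pexp f + pexp g.
Proof. by rewrite /pexp -big_split; apply: eq_bigr => z _; rewrite mulrDr. Qed.

Lemma pexpZ c f : pexp (fun z => c * f z) = c * pexp f.
Proof. by rewrite /pexp mulr_sumr; apply: eq_bigr => z _; rewrite mulrCA. Qed.

Lemma pweight_upd z i v : pweight z * w i v = pweight (upd z i v) * w i (z i).
Proof.
rewrite /pweight (bigD1 i) //= [in RHS](bigD1 i) //= upd_at.
rewrite mulrAC [RHS]mulrAC mulrC [RHS]mulrC [w i v * _]mulrC; congr (_ * _).
by apply: eq_bigr => k ki; rewrite ffunE (negbTE ki).
Qed.

(** Redrawing the [i]-th coordinate independently leaves the law unchanged: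
    the exchange of the old and the new value is a weight-preserving
    involution.  This is how independence of [z i] and the other cells enters. *)
Lemma pexp_resample i H :
  pexp H = pexp (fun z => \sum_v w i v * H (upd z i v)).
Proof.
transitivity (\sum_z \sum_v pweight z * w i v * H (upd z i v)); last first.
  by apply: eq_bigr => z _; rewrite mulr_sumr; apply: eq_bigr => v _; rewrite mulrA.
rewrite pair_bigA /=.
(* exchange of the current coordinate and the fresh draw *)
pose h (p : {ffun 'I_n -> 'I_n.+1} * 'I_n.+1) := (upd p.1 i p.2, p.1 i).
have hK : involutive h.
  by case=> z v; rewrite /h /= updK upd_id upd_at.
rewrite (reindex_inj (inv_inj hK)) /=.
rewrite -(pair_bigA _ (fun z v =>
  pweight (upd z i v) * w i (z i) * H (upd (upd z i v) i (z i)))) /=.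
apply: eq_bigr => z _.
transitivity (\sum_v w i v * (pweight z * H z)).
  by rewrite -mulr_suml w_sum mul1r.
apply: eq_bigr => v _.
by rewrite updK upd_id -pweight_upd; ring.
Qed.

Lemma pexp_tail i (k : nat) :
  pexp (fun z => (k <= z i)%N%:R) = \sum_(v : 'I_n.+1 | (k <= v)%N) w i v.
Proof.
rewrite (pexp_resample i).
transitivity (pexp (fun=> \sum_(v : 'I_n.+1 | (k <= v)%N) w i v)); last exact: pexp_cst.
apply: eq_bigr => z _; congr (_ * _); rewrite [RHS]big_mkcond /=.
by apply: eq_bigr => v _; rewrite upd_at; case: leqP; rewrite ?mulr1 ?mulr0.
Qed.

Section FalseRejections.
Variables (alpha : R) (N : {set 'I_n}).
Hypothesis alpha01 : 0 < alpha < 1.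
Hypothesis null_w : forall i, i \in N -> forall k : nat, (k < n)%N ->
  \sum_(v : 'I_n.+1 | (v <= k)%N) w i v <=
  k.+1%:R * alpha / (n%:R + 1 - k.+1%:R * (1 - alpha)).

Definition nrejected (A : {set 'I_n}) z : nat :=
  #|[set i in A | (z i <= stepdown z)%N]|.

Let al_gt0 : 0 < alpha. Proof. by case/andP: alpha01. Qed.
Let al_lt1 : alpha < 1. Proof. by case/andP: alpha01. Qed.

Let g (k : nat) : R := k.+1%:R * alpha / (n%:R - k%:R).

(** The critical values are designed for this: the odds of [c_(k+1)] are exactly
    [(k+1) alpha / (n-k)]. *)
Lemma null_odds i (k : nat) : i \in N -> (k < n)%N ->
  \sum_(v : 'I_n.+1 | (v <= k)%N) w i v <= g k * \sum_(v : 'I_n.+1 | (k < v)%N) w i v.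
Proof.
move=> iN kn; have /= H := null_w iN kn.
have -> : \sum_(v : 'I_n.+1 | (k < v)%N) w i v = 1 - \sum_(v : 'I_n.+1 | (v <= k)%N) w i v.
  rewrite -[1](w_sum i) [X in X - _](bigID (fun v : 'I_n.+1 => v <= k)%N) /= addrC addrK.
  by apply: eq_bigl => v; rewrite ltnNge.
set F := \sum_(v : 'I_n.+1 | (v <= k)%N) _ in H *.
have d0 : 0 < n%:R - k%:R :> R by rewrite subr_gt0 ltr_nat.
have a0 : 0 < k.+1%:R * alpha by rewrite mulr_gt0 ?ltr0Sn.
rewrite /g [leRHS]mulrAC ler_pdivlMr //.
move: H; rewrite -[k.+1%:R]natr1 in a0 * => H.
rewrite ler_pdivlMr in H; last by lra.
by lra.
Qed.

(** Each null is compared with its own leave-one-out count [K_i], which is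
    independent of [z i]; the odds inequality then trades the event that [i] is
    rejected for the event that it is accepted, on which [K_i] is the number [R]
    of rejections.  The remaining factor [(R+1) alpha / (n-R)] is compensated by
    the number of accepted nulls, which is at most [n - R]. *)
Lemma expected_false_rejections :
  (1 - alpha) * pexp (fun z => (nrejected N z)%:R) <= alpha * (#|~: N|.+1)%:R.
Proof.
suff H : pexp (fun z => (nrejected N z)%:R) <=
    alpha * (pexp (fun z => (nrejected N z)%:R) + (#|~: N|.+1)%:R) by lra.
have E1 : pexp (fun z => (nrejected N z)%:R) =
    \sum_(i in N) pexp (fun z => (z i <= stepdown_without z i)%N%:R).
  rewrite -pexp_sum; apply: eq_bigr => z _; congr (_ * _).
  rewrite /nrejected -sum1_card natr_sum [RHS]big_mkcond [LHS]big_mkcond /=.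
  apply: eq_bigr => i _; rewrite inE -rejected_without.
  by case: (i \in N) => //=; case: leqP.
have S1 i : i \in N -> pexp (fun z => (z i <= stepdown_without z i)%N%:R) <=
    pexp (fun z => (stepdown_without z i < z i)%N%:R * g (stepdown_without z i)).
  move=> iN; rewrite (pexp_resample i) [leRHS](pexp_resample i).
  apply: pexp_le => z.
  under eq_bigr do rewrite upd_at stepdown_without_upd.
  under [leRHS]eq_bigr do rewrite upd_at stepdown_without_upd.
  have := null_odds iN (stepdown_without_lt z i); rewrite mulr_sumr.
  rewrite big_mkcond [in X in _ <= X]big_mkcond /=.
  set A := \sum_v _; set B := \sum_v _ => AB.
  suff [-> ->] : \sum_v w i v * (v <= stepdown_without z i)%N%:R = A /\
    \sum_v w i v * ((stepdown_without z i < v)%N%:R * g (stepdown_without z i)) = B by [].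
  split; apply: eq_bigr => v _; case: leqP;
    by rewrite ?mulr1 ?mulr0 ?mul0r ?mulr0 ?mul1r // mulrC.
rewrite [leLHS]E1; apply: (le_trans (ler_sum _ S1)).
rewrite -pexp_sum.
rewrite -(pexp_cst (#|~: N|.+1)%:R) -pexpD -pexpZ; apply: pexp_le => z.
have -> : \sum_(i in N) (stepdown_without z i < z i)%N%:R * g (stepdown_without z i) =
    #|[set i in N | (stepdown z < z i)%N]|%:R * g (stepdown z).
  rewrite -sum1_card natr_sum mulr_suml [LHS]big_mkcond [RHS]big_mkcond /=.
  apply: eq_bigr => i _; rewrite inE; case: (i \in N) => //=.
  have := rejected_without z i; case: (ltnP (stepdown z) (z i)) => H1;
    case: (ltnP (stepdown_without z i) (z i)) => H2 //.
  - by rewrite (stepdown_without_accepted H2).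
  - by rewrite mul0r.
have cR := card_rejected z.
have c1 : (nrejected N z + #|[set i in N | (stepdown z < z i)%N]| = #|N|)%N.
  rewrite /nrejected -(cardsID [set i | (z i <= stepdown z)%N] N); congr (_ + _)%N.
    by apply: eq_card => i; rewrite !inE.
  by apply: eq_card => i; rewrite !inE -ltnNge andbC.
have c2 : (stepdown z <= nrejected N z + #|~: N|)%N.
  pose A := [set i | (z i <= stepdown z)%N].
  apply: (@leq_trans (#|A :&: N| + #|A :\: N|)%N).
    by rewrite cardsID cR.
  apply: leq_add.
    by apply/subset_leq_card/fintype.subsetP => i; rewrite !inE andbC.
  by apply/subset_leq_card/fintype.subsetP => i; rewrite !inE => /andP[].
have c3 : (#|[set i in N | (stepdown z < z i)%N]| + stepdown z <= n)%N.
  rewrite -[X in (_ + X)%N]cR -cardsUI.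
  rewrite (_ : _ :&: _ = finset.set0) ?cards0 ?addn0.
    by rewrite -[X in (_ <= X)%N]card_ord max_card.
  by apply/setP => i; rewrite !inE ltnNge -andbA andNb andbF.
set m := #|_| in c1 c3 *.
apply: (@le_trans _ _ (alpha * (stepdown z).+1%:R)); last first.
  rewrite ler_pM2l //.
  by rewrite -natrD ler_nat addnS ltnS.
rewrite /g; move: c3; case: (posnP m) => [-> _|m0 c3].
  by rewrite mul0r mulr_ge0// ltW.
have d0 : 0 < n%:R - (stepdown z)%:R :> R by rewrite subr_gt0 ltr_nat; lia.
rewrite mulrA ler_pdivrMr // mulrC [X in X * _]mulrC ler_wpM2l //.
  by rewrite mulr_ge0// ltW.
by rewrite lerBrDr -natrD ler_nat.
Qed.

End FalseRejections.
End ProductWeights.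

(** * Probability of stopping early *)

Section Power.
Variables (R : realType) (n : nat) (w : 'I_n -> 'I_n.+1 -> R).
Hypothesis w_ge0 : forall i v, 0 <= w i v.
Hypothesis w_sum : forall i, \sum_v w i v = 1.
Variable G : {set 'I_n}.

(** Chernoff's bound with the exponential moment of order [-1]: an index
    of [G] that lies below level [j] with probability [p >= q] contributes a
    factor [1 - p (1 - 1/e) <= exp (- q/2)]. *)
Lemma card_below_chernoff (q : R) (j : nat) :
  (forall i, i \in G -> q <= \sum_(v : 'I_n.+1 | (v < j)%N) w i v) ->
  pexp w (fun z => (card_below z j < j)%N%:R) <= expR (j%:R - #|G|%:R * q / 2).
Proof.
move=> Hq.
(* [\prod_i f i (z i)] is [exp (- N)], where [N] counts the indices of [G] below
   level [j]. *)
pose f i (v : 'I_n.+1) : R := if (i \in G) && (v < j)%N then expR (-1) else 1.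
apply: (@le_trans _ _ (pexp w (fun z => expR j%:R * \prod_i f i (z i)))).
  apply: pexp_le => // z.
  have -> : \prod_i f i (z i) = expR (- #|[set i in G | (z i < j)%N]|%:R).
    rewrite -sum1_card natr_sum -sumrN expR_sum [RHS]big_mkcond /=.
    by apply: eq_bigr => i _; rewrite inE.
  rewrite -expRD; case: ltnP => H; last exact: expR_ge0.
  rewrite -[leLHS]expR0 ler_expR subr_ge0 ler_nat ltnW //; apply: leq_ltn_trans H.
  by apply/subset_leq_card/fintype.subsetP => i; rewrite !inE => /andP[].
rewrite pexpZ pexp_prod expRD; apply: ler_wpM2l; first exact: expR_ge0.
apply: (@le_trans _ _ (\prod_(i in G) expR (- (q / 2)))); last first.
  by rewrite -expR_sum sumr_const ler_expR -[leLHS]mulr_natl; lra.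
rewrite [leRHS]big_mkcond /=; apply: ler_prod => i _.
apply/andP; split.
  apply: sumr_ge0 => v _; apply: mulr_ge0; first exact: w_ge0.
  rewrite /f; case: ifP => _; last exact: ler01.
  exact: expR_ge0.
case: ifP => iG; last first.
  by rewrite /f iG /=; under eq_bigr do rewrite mulr1; rewrite w_sum.
have e2 : expR (-1) <= 2^-1 :> R.
  by rewrite expRN lef_pV2 ?posrE ?expR_gt0// (le_trans _ (expR_ge1Dx _)).
apply: (@le_trans _ _ (1 - q / 2)); last exact: (le_trans _ (expR_ge1Dx _)).
have /= E := w_sum i.
rewrite (bigID (fun v : 'I_n.+1 => (v < j)%N)) /= in E.
rewrite (bigID (fun v : 'I_n.+1 => (v < j)%N)) /=.
have -> : \sum_(v : 'I_n.+1 | (v < j)%N) w i v * f i v =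
    (\sum_(v : 'I_n.+1 | (v < j)%N) w i v) * expR (-1).
  by rewrite mulr_suml; apply: eq_bigr => v vj; rewrite /f iG vj.
have -> : \sum_(v : 'I_n.+1 | ~~ (v < j)%N) w i v * f i v =
    \sum_(v : 'I_n.+1 | ~~ (v < j)%N) w i v.
  by apply: eq_bigr => v /negbTE vj; rewrite /f iG vj mulr1.
have := Hq i iG.
set Q := \sum_(v : 'I_n.+1 | (v < j)%N) w i v in E * => qQ.
have Q0 : 0 <= Q by apply: sumr_ge0.
have : Q * expR (-1) <= Q * 2^-1 by rewrite ler_wpM2l.
lra.
Qed.

(** With [x = exp (-A)], the bound [A x <= 1 - x] makes the sum telescope. *)
Lemma geometric_tail (A : R) (k : nat) : 0 < A ->
  \sum_(0 <= j < k) expR (- (A * j.+1%:R)) <= A^-1.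
Proof.
move=> A0; pose x := expR (- A).
have x0 : 0 < x by exact: expR_gt0.
have Ax : A * x <= 1 - x.
  rewrite lerBrDr -[X in _ + X]mul1r -mulrDl /x expRN.
  by rewrite ler_pdivrMr ?expR_gt0 // mul1r addrC expR_ge1Dx.
have E j : expR (- (A * j%:R)) = x ^+ j.
  by rewrite /x -expRM_natl mulrN mulrC.
under eq_bigr do rewrite E.
rewrite -(ler_pM2l A0) divff ?gt_eqF //.
suff : A * (\sum_(0 <= j < k) x ^+ j.+1) <= 1 - x ^+ k.
  by move=> /le_trans; apply; rewrite lerBlDr lerDl exprn_ge0 // ltW.
elim: k => [|k IH]; first by rewrite big_geq // mulr0 expr0 subrr.
rewrite big_nat_recr //= mulrDr.
have := ler_wpM2l (exprn_ge0 k (ltW x0)) Ax.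
rewrite !exprS; lra.
Qed.

(** If the procedure stops at [r < k], then fewer than [r+1] p-values lie below
    [c_(r+1)].  The union bound over [r] is affordable because the failure
    probabilities decrease geometrically in [r]. *)
Lemma early_stop_le (A : R) (q : nat -> R) (k : nat) : 0 < A -> (k <= n)%N ->
  (forall j, (0 < j <= k)%N -> forall i, i \in G ->
     q j <= \sum_(v : 'I_n.+1 | (v < j)%N) w i v) ->
  (forall j, (0 < j <= k)%N -> (2 + 2 * A) * j%:R <= #|G|%:R * q j) ->
  pexp w (fun z => (stepdown z < k)%N%:R) <= A^-1.
Proof.
move=> A0 kn Hq HM; apply: le_trans (geometric_tail k A0).
apply: (@le_trans _ _ (pexp w (fun z => \sum_(0 <= j < k) (card_below z j.+1 < j.+1)%N%:R))).
  apply: pexp_le => // z; case: ltnP => [Rk|_]; last exact: sumr_ge0.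
  rewrite (bigD1_seq (stepdown z)) ?mem_index_iota ?iota_uniq //=.
  rewrite ltnS stepdown_fail ?(leq_trans Rk) //.
  by rewrite lerDl sumr_ge0.
rewrite pexp_sum [leLHS]big_nat [leRHS]big_nat; apply: ler_sum => j /andP[_ jk].
apply: (le_trans (card_below_chernoff (Hq j.+1 _))) => //.
rewrite ler_expR; have := HM j.+1; rewrite jk => /(_ isT).
lra.
Qed.

(** A signal is missed either because the procedure stops before [k], or because
    its p-value exceeds [c_k]. *)
Lemma expected_missed (S : {set 'I_n}) (k : nat) :
  pexp w (fun z => #|[set i in S | (stepdown z < z i)%N]|%:R) <=
  #|S|%:R * pexp w (fun z => (stepdown z < k)%N%:R) +
  \sum_(i in S) \sum_(v : 'I_n.+1 | (k <= v)%N) w i v.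
Proof.
have -> : \sum_(i in S) \sum_(v : 'I_n.+1 | (k <= v)%N) w i v =
    pexp w (fun z => \sum_(i in S) (k <= z i)%N%:R).
  by rewrite pexp_sum; apply: eq_bigr => i _; rewrite pexp_tail.
rewrite -pexpZ -pexpD; apply: pexp_le => // z.
rewrite -!sum1_card !natr_sum mulr_suml -big_split /=.
rewrite [leLHS]big_mkcond [leRHS]big_mkcond /=; apply: ler_sum => i _.
rewrite inE; case: (i \in S) => //=; rewrite mul1r.
case: (ltnP (stepdown z) (z i)) => Rz; last by rewrite addr_ge0.
case: ltnP => [|kR]; first by rewrite lerDl.
by rewrite (leq_trans kR (ltnW Rz)) add0r.
Qed.

End Power.

Local Open Scope classical_set_scope.
Local Open Scope ring_scope.

(** * The normal tail *)

Section Gaussian.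
Variable R : realType.
Local Notation mu := lebesgue_measure.
Local Notation N01 := (@normal_prob R 0 1).

Definition gauss (A : set R) : R := fine (N01 A).

Lemma gaussE (A : set R) : measurable A -> N01 A = (gauss A)%:E.
Proof. by move=> mA; rewrite /gauss fineK // fin_num_measure. Qed.

Lemma gauss_ge0 (A : set R) : 0 <= gauss A.
Proof. by rewrite fine_ge0. Qed.

Lemma le_gauss (A B : set R) : measurable A -> measurable B -> A `<=` B ->
  gauss A <= gauss B.
Proof.
move=> mA mB AB; rewrite -lee_fin -!gaussE //.
by apply: le_measure => //; rewrite inE.
Qed.

Lemma normal_pdf1E (m t : R) :
  normal_pdf m 1 t = normal_peak 1 * expR (- ((t - m) ^+ 2 / 2)).
Proof.
rewrite normal_pdfE ?oner_eq0 // -mulNr.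
transitivity (normal_peak 1 * normal_fun m 1 t) => //.
by rewrite /normal_fun expr1n.
Qed.

Lemma gaussC (A : set R) : measurable A -> gauss (~` A) = 1 - gauss A.
Proof.
move=> mA; apply: EFin_inj; rewrite EFinB -!gaussE //; last exact: measurableC.
exact: probability_setC.
Qed.

(** The density is even and Lebesgue measure is invariant under reflection. *)
Lemma gaussN (A : set R) : measurable A -> gauss (-%R @^-1` A) = gauss A.
Proof.
move=> mA; rewrite /gauss; congr fine; rewrite /normal_prob.
have mf : measurable_fun [set: R] (EFin \o (normal_pdf 0 1 : R -> R)).
  by apply/measurable_EFinP; exact: measurable_normal_pdf.
transitivity (\int[mu]_(x in -%R @^-1` A)
    ((EFin \o (normal_pdf 0 1 : R -> R)) \o -%R) x)%E.
  apply: eq_integral => x _ /=; congr EFin.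
  by rewrite !normal_pdf1E !subr0 sqrrN.
pose phi : measurableTypeR R -> measurableTypeR R := -%R.
have mphi : measurable_fun [set: measurableTypeR R] phi.
  exact: oppr_measurable.
etransitivity.
  apply/esym/(ge0_integral_pushforward mphi mu mA); first exact: measurable_funS mf.
  by move=> x _; rewrite lee_fin normal_pdf_ge0.
by apply: eq_measure_integral => //= B mB BS; exact: lebesgue_measureN.
Qed.

Lemma barPhiE (x : R) : barPhi x = gauss `]x, +oo[.
Proof.
by rewrite /barPhi /Phi -/(gauss _) -gaussC // setCitvl.
Qed.

Lemma gauss_set1 (x : R) : gauss [set x] = 0.
Proof.
rewrite /gauss; suff -> : N01 [set x] = 0%E by [].
have H := @normal_prob_dominates R 0 1.
have /null_content_dominatesP := H; apply => //.
exact: lebesgue_measure_set1.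
Qed.

Lemma barPhi_co (x : R) : gauss `[x, +oo[ = barPhi x.
Proof.
rewrite barPhiE; apply/eqP; rewrite eq_le; apply/andP; split; last first.
  by apply: le_gauss => //; apply: subset_itvr; rewrite bnd_simp.
rewrite -(setU1itv false) ?bnd_simp // -[leRHS]add0r -(gauss_set1 x).
rewrite -lee_fin EFinD -!gaussE //.
  by apply: measureU2.
by apply: measurableU.
Qed.

Lemma barPhiN (x : R) : barPhi (- x) = 1 - barPhi x.
Proof.
rewrite -barPhi_co -gaussN // opp_preimage_itvbndy opprK.
by rewrite /barPhi /Phi -/(gauss _) opprB addrCA subrr addr0.
Qed.

Lemma barPhi_ge0 (x : R) : 0 <= barPhi x.
Proof. by rewrite barPhiE gauss_ge0. Qed.

Lemma barPhi_anti (x y : R) : x <= y -> barPhi y <= barPhi x.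
Proof.
move=> xy; rewrite !barPhiE; apply: le_gauss => //.
by apply: subset_itvr; rewrite bnd_simp.
Qed.

Lemma normal_peak1_le1 : normal_peak (1 : R) <= 1.
Proof.
rewrite /normal_peak invf_le1 ?sqrtr_gt0; last first.
  by rewrite expr1n mul1r mulrn_wgt0 // pi_gt0.
rewrite -[leLHS]sqrtr1 ler_sqrt; last by rewrite expr1n mul1r mulrn_wge0 // pi_ge0.
rewrite expr1n mul1r; have := @pi_ge2 R; lra.
Qed.

Lemma gauss_itv_le (x y c : R) : 0 <= c -> x <= y ->
  (forall t, x <= t <= y -> normal_pdf 0 1 t <= c) ->
  gauss `]x, y] <= c * (y - x).
Proof.
move=> c0 xy Hc; rewrite -lee_fin -gaussE //.
have -> : (c * (y - x))%:E = (\int[mu]_(t in `]x, y]) (cst c%:E) t)%E.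
  rewrite integral_cst //= lebesgue_measure_itv /= lte_fin.
  move: xy; rewrite le_eqVlt => /predU1P[->|xy].
    by rewrite subrr mulr0 ltxx mule0.
  by rewrite xy -EFinD -EFinM.
apply: ge0_le_integral => //.
- by move=> t _; rewrite lee_fin normal_pdf_ge0.
- by apply/measurable_EFinP; apply: measurable_funTS; exact: measurable_normal_pdf.
- by move=> t; rewrite /= in_itv /= => /andP[/ltW xt ty]; rewrite lee_fin Hc // xt.
Qed.

Lemma gauss_itv_ge (x y c : R) : 0 <= c -> x <= y ->
  (forall t, x <= t <= y -> c <= normal_pdf 0 1 t) ->
  c * (y - x) <= gauss `]x, y].
Proof.
move=> c0 xy Hc; rewrite -lee_fin -gaussE //.
have -> : (c * (y - x))%:E = (\int[mu]_(t in `]x, y]) (cst c%:E) t)%E.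
  rewrite integral_cst //= lebesgue_measure_itv /= lte_fin.
  move: xy; rewrite le_eqVlt => /predU1P[->|xy].
    by rewrite subrr mulr0 ltxx mule0.
  by rewrite xy -EFinD -EFinM.
apply: ge0_le_integral => //.
- by apply/measurable_EFinP; apply: measurable_funTS; exact: measurable_normal_pdf.
- by move=> t; rewrite /= in_itv /= => /andP[/ltW xt ty]; rewrite lee_fin Hc // xt.
Qed.

Lemma barPhiB (x y : R) : x <= y -> barPhi x - barPhi y = gauss `]x, y].
Proof.
move=> xy; rewrite !barPhiE; apply: EFin_inj; rewrite EFinB -!gaussE //.
have -> : [set` `]x, +oo[] = [set` `]x, y]] `|` [set` `]y, +oo[] :> set R.
  by rewrite -itv_bndbnd_setU // bnd_simp.
rewrite measureU //; last first.
  apply/seteqP; split => // t /=; rewrite !in_itv /= andbT => -[/andP[_ ty]].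
  by rewrite ltNge ty.
by rewrite addeK // fin_num_measure.
Qed.

Lemma barPhi_lipschitz (x y : R) : x <= y -> barPhi x <= barPhi y + (y - x).
Proof.
move=> xy; rewrite -lerBlDl barPhiB // -[leRHS]mul1r.
apply: gauss_itv_le => // t _; apply: le_trans (normal_pdf_ub _ _ _) _.
  exact: oner_neq0.
exact: normal_peak1_le1.
Qed.

(** For [t >= x >= 0] one has [t^2 >= x^2 + (t - x)^2], so the density at [t] is
    at most [exp (- x^2/2)] times the density of the normal law centred at [x],
    which has total mass 1. *)
Lemma barPhi_tail (x : R) : 0 <= x -> barPhi x <= expR (- (x ^+ 2 / 2)).
Proof.
move=> x0; rewrite barPhiE -lee_fin -gaussE // /normal_prob.
pose f : R -> \bar R :=
  fun t => ((expR (- (x ^+ 2 / 2)))%:E * (normal_pdf x 1 t)%:E)%E.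
have mx : measurable_fun [set: R] (EFin \o (normal_pdf x 1 : R -> R)).
  by apply/measurable_EFinP; exact: measurable_normal_pdf.
have mf : measurable_fun [set: R] f by apply: emeasurable_funM.
have -> : (expR (- (x ^+ 2 / 2)))%:E = (\int[mu]_t f t)%E.
  rewrite /f ge0_integralZl // ?lee_fin ?expR_ge0 //.
    by rewrite integral_normal_pdf mule1.
  by move=> t _; rewrite lee_fin normal_pdf_ge0.
apply: (@le_trans _ _ (\int[mu]_(t in `]x, +oo[) f t)%E); last first.
  apply: ge0_subset_integral => // t _.
  by rewrite /f -EFinM lee_fin mulr_ge0 ?expR_ge0 ?normal_pdf_ge0.
apply: ge0_le_integral => //.
- by move=> t _; rewrite lee_fin normal_pdf_ge0.
- by apply/measurable_EFinP; apply: measurable_funTS; exact: measurable_normal_pdf.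
- exact: measurable_funTS.
move=> t; rewrite /= in_itv /= andbT => xt.
rewrite /f -EFinM lee_fin !normal_pdf1E mulrCA ler_wpM2l //.
  exact: normal_peak_ge0.
rewrite -expRD ler_expR.
have : 0 <= x * (t - x) by rewrite mulr_ge0 // subr_ge0 ltW.
by rewrite !expr2; lra.
Qed.

(** The density is decreasing on the positive axis and the tail contains
    [[z, z+1]]. *)
Lemma barPhi_lower (z : R) : 0 <= z ->
  normal_peak 1 * expR (- ((z + 1) ^+ 2 / 2)) <= barPhi z.
Proof.
move=> z0; have z1 : z <= z + 1 by rewrite lerDl.
set c := normal_peak 1 * _.
apply: (@le_trans _ _ (gauss `]z, z + 1])); last first.
  by rewrite -barPhiB // gerBl barPhi_ge0.
apply: (@le_trans _ _ (c * (z + 1 - z))).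
  by rewrite addrAC subrr add0r mulr1.
apply: gauss_itv_ge => //.
  by rewrite mulr_ge0 ?normal_peak_ge0 ?expR_ge0.
move=> t /andP[zt tz]; rewrite normal_pdf1E /c ler_wpM2l ?normal_peak_ge0 //.
rewrite ler_expR subr0 lerN2 ler_pM2r //.
by rewrite ler_pXn2r // nnegrE; lra.
Qed.

Lemma measurable_barPhi_abs : measurable_fun [set: R] (fun t : R => 2 * barPhi `|t|).
Proof.
apply: measurable_funM => //.
apply: (@measurableT_comp _ _ _ _ _ _ (@barPhi R) _ (fun t : R => `|t|)) => //.
apply: nonincreasing_measurable => // x y; exact: barPhi_anti.
Qed.

Lemma gauss_abs_ge (t : R) : gauss [set x | t <= `|x|] <= 2 * barPhi t.
Proof.
have -> : [set x | t <= `|x|] = [set` `[t, +oo[] `|` -%R @^-1` [set` `[t, +oo[] :> set R.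
  apply/seteqP; split => x /=; rewrite !in_itv /= !andbT.
    by rewrite ler_normr => /orP[]; [left|right].
  by rewrite ler_normr => -[->|->]; rewrite ?orbT.
have mN : measurable (-%R @^-1` [set` `[t, +oo[] : set R).
  by rewrite opp_preimage_itvbndy.
rewrite mulr_natl mulr2n -{1}barPhi_co -barPhi_co -[X in _ + X]gaussN //.
rewrite -lee_fin EFinD -!gaussE //; last exact: measurableU.
exact: measureU2.
Qed.

(** The set of [t >= 0] with [2 barPhi t <= c] starts at some [t0]; by continuity
    [2 barPhi t0 <= c] up to an arbitrarily small [h], and the event is contained
    in [t0 <= |x|]. *)
Lemma null_superuniform (c : R) : 0 < c ->
  gauss [set x | 2 * barPhi `|x| <= c] <= c.
Proof.
move=> c0; set B := [set x | _].
have mB : measurable B.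
  rewrite /B -[X in measurable X]setTI.
  have := measurable_barPhi_abs measurableT (measurable_itv `]-oo, c]).
  by congr measurable; congr (_ `&` _); apply/seteqP; split => x /=; rewrite in_itv.
apply/ler_addgt0Pr => h h0.
pose D := [set t : R | 0 <= t /\ 2 * barPhi t <= c].
have [D0|] := pselect (D !=set0); last first.
  move=> D0; suff -> : B = set0.
    by rewrite /gauss measure0 /= addr_ge0 // ltW.
  apply/seteqP; split => // x Bx; apply: D0; exists `|x|; split => //.
have lD : has_inf D by split => //; exists 0 => t [].
pose h2 := h / 2; have h20 : 0 < h2 by rewrite divr_gt0.
have [t [t0 tc] th] := inf_adherent h20 lD.
apply: (@le_trans _ _ (gauss [set x | inf D <= `|x|])).
  apply: le_gauss => //.
    rewrite -[X in measurable X]setTI.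
    have := @normr_measurable R setT measurableT _ (measurable_itv `[inf D, +oo[).
    congr measurable; congr (_ `&` _); apply/seteqP; split => x /=;
      by rewrite in_itv /= andbT.
  move=> x Bx; apply: ge_inf; first by case: lD.
  by split.
apply: (le_trans (gauss_abs_ge _)).
have := @barPhi_lipschitz (inf D) t; rewrite ge_inf //; last by case: lD.
move=> /(_ isT) H; rewrite /h2 in th; lra.
Qed.

(** An accepted observation lies below the threshold [x] in absolute value; only
    the side towards the origin is kept. *)
Lemma accept_prob_le (th x c : R) : barPhi x <= c / 2 ->
  gauss [set e | c < 2 * barPhi `|th + e|] <= barPhi (`|th| - x).
Proof.
move=> xc; set B := [set e | _].
have mB : measurable B.
  rewrite /B -[X in measurable X]setTI.
  have mf : measurable_fun [set: R] (fun e : R => 2 * barPhi `|th + e|).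
    apply: (@measurableT_comp _ _ _ _ _ _ (fun t : R => 2 * barPhi `|t|) _
      (fun e => th + e)) => //.
      exact: measurable_barPhi_abs.
    exact: measurable_funD.
  have := mf measurableT _ (measurable_itv `]c, +oo[).
  congr measurable; congr (_ `&` _); apply/seteqP; split => y /=;
    by rewrite in_itv /= andbT.
have Bx e : B e -> `|th + e| < x.
  move=> Be; rewrite ltNge; apply/negP => /barPhi_anti H.
  have : c < 2 * barPhi `|th + e| by [].
  by move=> Bc; lra.
rewrite barPhiE.
case: (lerP 0 th) => th0; [rewrite ger0_norm //|rewrite ltr0_norm //].
  rewrite -[leRHS]gaussN // opp_preimage_itvbndy; apply: le_gauss => // e /Bx.
  rewrite ltr_norml /= in_itv /= => /andP[_ H]; lra.
apply: le_gauss => // e /Bx.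
rewrite ltr_norml /= in_itv /= andbT => /andP[H _]; lra.
Qed.

Lemma barPhi_small (d : R) : 0 < d -> exists2 K, 0 <= K & barPhi K <= d.
Proof.
move=> d0; exists (2 / d + 1).
  by rewrite addr_ge0 // divr_ge0 // ltW.
have K1 : 1 <= 2 / d + 1 by rewrite lerDr divr_ge0 // ltW.
set K := 2 / d + 1 in K1 *.
apply: (le_trans (barPhi_tail _)); first lra.
rewrite expRN -[leRHS]invrK lef_pV2 ?posrE ?expR_gt0 ?invr_gt0 //.
apply: le_trans (expR_ge1Dx _).
have Kd : d^-1 <= K / 2 by rewrite /K; lra.
have : K * 1 <= K * K by rewrite ler_pM2l //; lra.
rewrite expr2; lra.
Qed.

End Gaussian.

(** * From p-values to cells *)

Section Discretisation.
Variables (R : realType) (n : nat) (alpha : R).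
Hypothesis alpha01 : 0 < alpha < 1.

Lemma gbs_denom_gt0 (k : nat) : (k <= n)%N ->
  0 < n%:R + 1 - k%:R * (1 - alpha) :> R.
Proof.
move=> kn; have /andP[a0 a1] := alpha01.
have : k%:R * (1 - alpha) <= n%:R * 1 :> R.
  by rewrite ler_pM ?ler_nat //; lra.
lra.
Qed.

Lemma gbs_crit_mono (j k : nat) : (j <= k <= n)%N ->
  gbs_crit n alpha j <= gbs_crit n alpha k.
Proof.
move=> /andP[jk kn]; have /andP[a0 a1] := alpha01.
have jk' : j%:R <= k%:R :> R by rewrite ler_nat.
have jk1 : j%:R * (1 - alpha) <= k%:R * (1 - alpha) by rewrite ler_wpM2r //; lra.
have d1 := gbs_denom_gt0 (leq_trans jk kn); have d2 := gbs_denom_gt0 kn.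
apply: ler_pM; first by rewrite mulr_ge0 // ltW.
- by rewrite invr_ge0 ltW.
- by rewrite ler_wpM2r // ltW.
- by rewrite lef_pV2 ?posrE //; lra.
Qed.

(** The number of critical values below [p]; as the critical values increase,
    this locates [p] among them. *)
Definition cell_rank (p : R) : nat := (\sum_(k < n) (gbs_crit n alpha k.+1 < p)%R)%N.

Lemma cell_rank_le p : (cell_rank p <= n)%N.
Proof.
rewrite /cell_rank -[X in (_ <= X)%N]card_ord -sum1_card.
by apply: leq_sum => k _; case: (_ < _).
Qed.

Definition cell (p : R) : 'I_n.+1 := inord (cell_rank p).

Lemma cell_lt p j : (0 < j <= n)%N -> (cell p < j)%N = (p <= gbs_crit n alpha j).
Proof.
move=> /andP[j0 jn]; rewrite /cell inordK ?ltnS ?cell_rank_le //.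
have [pj|jp] := leP p (gbs_crit n alpha j).
  rewrite /cell_rank; have -> : (j = j.-1.+1)%N by rewrite prednK.
  rewrite ltnS; apply: (@leq_trans (\sum_(k < n | (k < j.-1)%N) 1)%N).
    rewrite [X in (_ <= X)%N]big_mkcond /=; apply: leq_sum => k _.
    case: ltnP => [_|jk]; first by case: (_ < _).
    rewrite ltNge (le_trans pj) //; apply: gbs_crit_mono.
    by rewrite ltn_ord andbT -(prednK j0) ltnS.
  rewrite -(big_ord_widen n (fun _ => 1%N)); last exact: leq_trans (leq_pred _) jn.
  by rewrite sum1_card card_ord.
apply/negbTE; rewrite -leqNgt /cell_rank.
apply: (@leq_trans (\sum_(k < n | (k < j)%N) 1)%N).
  by rewrite -(big_ord_widen n (fun _ => 1%N)) // sum1_card card_ord.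
rewrite big_mkcond /=; apply: leq_sum => k _; case: ltnP => // kj.
by rewrite (le_lt_trans _ jp) //; apply: gbs_crit_mono; rewrite kj.
Qed.

Definition cells (x : 'rV[R]_n) : {ffun 'I_n -> 'I_n.+1} :=
  [ffun i => cell (pval x i)].

Lemma count_pvals_le (x : 'rV[R]_n) (c : R) :
  count (<= c) (sorted_pvals x) = #|[set i | pval x i <= c]%SET|.
Proof.
rewrite /sorted_pvals count_sort count_map -sum1_count -sum1_card big_enum_cond /=.
by apply: eq_bigl => i; rewrite inE.
Qed.

Lemma count_pvals_crit (x : 'rV[R]_n) (j : nat) : (0 < j <= n)%N ->
  count (<= gbs_crit n alpha j) (sorted_pvals x) = card_below (cells x) j.
Proof.
move=> jn; rewrite count_pvals_le; apply: eq_card => i.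
by rewrite !inE ffunE cell_lt.
Qed.

Lemma size_sorted_pvals (x : 'rV[R]_n) : size (sorted_pvals x) = n.
Proof. by rewrite size_sort size_map -cardE card_ord. Qed.

Lemma sorted_sorted_pvals (x : 'rV[R]_n) : sorted <=%R (sorted_pvals x).
Proof. exact: sort_sorted le_total _. Qed.

Lemma ordered_pval_le (x : 'rV[R]_n) (j : nat) : (0 < j <= n)%N ->
  (ordered_pval x j <= gbs_crit n alpha j) = (j <= card_below (cells x) j)%N.
Proof.
move=> jn; rewrite -count_pvals_crit //; case/andP: jn => j0 jn.
rewrite /ordered_pval -{3}(prednK j0).
have [H|H] := ltnP j.-1 (count (<= gbs_crit n alpha j) (sorted_pvals x)).
  by apply: nth_count_le H; exact: sorted_sorted_pvals.
apply/negbTE; rewrite -ltNge; apply: nth_count_gt.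
  exact: sorted_sorted_pvals.
by rewrite H size_sorted_pvals prednK.
Qed.

Lemma gbs_R_stepdown (x : 'rV[R]_n) : gbs_R alpha x = stepdown (cells x).
Proof.
apply: eq_bigl => r; apply: eq_forallb => j.
case: (boolP (0 < j <= r)%N) => //= /andP[j0 _].
by rewrite ordered_pval_le // j0 -ltnS ltn_ord.
Qed.

(** The procedure is defined by membership in the list of the [R] smallest
    p-values; by [card_rejected] that list consists of the p-values at most
    [c_(R+1)], unless everything is rejected. *)
Lemma gbs_stepdown (x : 'rV[R]_n) i :
  gbs alpha x i = (cells x i <= stepdown (cells x))%N.
Proof.
rewrite ffunE gbs_R_stepdown.
have pin : pval x i \in sorted_pvals x.
  by rewrite mem_sort; apply: map_f; rewrite mem_enum.
have [nR|Rn] := leqP n (stepdown (cells x)).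
  rewrite take_oversize ?size_sorted_pvals // pin.
  by apply/esym/(leq_trans _ nR); rewrite -ltnS.
have R1 : (0 < (stepdown (cells x)).+1 <= n)%N by [].
have <- : count (<= gbs_crit n alpha (stepdown (cells x)).+1) (sorted_pvals x) =
    stepdown (cells x).
  by rewrite count_pvals_crit // -[RHS]card_rejected.
rewrite -sorted_filter_le ?sorted_sorted_pvals // mem_filter pin andbT.
rewrite count_pvals_crit // -[in RHS]ltnS.
have -> : card_below (cells x) (stepdown (cells x)).+1 = stepdown (cells x).
  by rewrite -[RHS]card_rejected.
by rewrite ffunE cell_lt.
Qed.

Definition nulls (theta : 'rV[R]_n) : {set 'I_n} := [set i | theta 0 i == 0]%SET.

Lemma errors_stepdown (theta x : 'rV[R]_n) :
  (V theta (gbs alpha x) + T theta (gbs alpha x))%N =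
  (nrejected (nulls theta) (cells x) +
   #|[set i in ~: nulls theta | (stepdown (cells x) < cells x i)%N]%SET|)%N.
Proof.
rewrite /V /T /nrejected -!sum1_card; congr (_ + _)%N.
  rewrite big_mkcond [RHS]big_mkcond /=; apply: eq_bigr => i _.
  by rewrite !inE gbs_stepdown; case: eqP => //=; case: leq.
rewrite big_mkcond [RHS]big_mkcond /=; apply: eq_bigr => i _.
by rewrite !inE gbs_stepdown ltnNge; case: eqP => //=; case: leq.
Qed.

End Discretisation.

(** * The law of the cells *)

Lemma integral_finite_valued (R : realType) (d : measure_display)
    (T : measurableType d) (mu : {measure set T -> \bar R}) (F : finType)
    (c : T -> F) (h : F -> R) :
  (forall v, measurable (c @^-1` [set v])) -> (forall v, 0 <= h v) ->
  (\int[mu]_t (h (c t))%:E = \sum_v (h v)%:E * mu (c @^-1` [set v]))%E.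
Proof.
move=> mc h0.
transitivity (\int[mu]_t (\sum_(v <- index_enum F)
    (h v)%:E * (\1_(c @^-1` [set v]) t)%:E))%E.
  apply: eq_integral => t _; rewrite (bigD1 (c t)) //= big1 ?adde0.
    by rewrite indicE mem_set // mule1.
  by move=> v /eqP vc; rewrite indicE memNset ?mule0 //= => /esym.
rewrite ge0_integral_sum //.
- apply: eq_bigr => v _; rewrite ge0_integralZl //; last by rewrite lee_fin h0.
  + by rewrite integral_indic // setIT.
  + by apply/measurable_EFinP; exact: measurable_indic.
- move=> v; apply: emeasurable_funM => //.
  by apply/measurable_EFinP; exact: measurable_indic.
- by move=> v t _; rewrite -EFinM lee_fin mulr_ge0.
Qed.

Section CellLaw.
Variables (R : realType) (n : nat) (alpha : R).
Hypothesis alpha01 : 0 < alpha < 1.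
Variable theta : 'rV[R]_n.

Definition cell_obs (i : 'I_n) (e : R) : 'I_n.+1 :=
  cell n alpha (2 * barPhi `|theta 0 i + e|).

Lemma measurable_pval_shift i :
  measurable_fun [set: R] (fun e : R => 2 * barPhi `|theta 0 i + e|).
Proof.
apply: (@measurableT_comp _ _ _ _ _ _ (fun t : R => 2 * barPhi `|t|) _
  (fun e => theta 0 i + e)) => //.
  exact: measurable_barPhi_abs.
exact: measurable_funD.
Qed.

Lemma measurable_pval_le i c :
  measurable [set e : R | 2 * barPhi `|theta 0 i + e| <= c].
Proof.
have H := measurable_pval_shift i measurableT (measurable_itv `]-oo, c]).
by rewrite setTI in H.
Qed.

Lemma measurable_cell_lt i (j : nat) : measurable [set e | (cell_obs i e < j)%N].
Proof.
case: (posnP j) => [->|j0]; first by rewrite (_ : mkset _ = set0) //; apply/seteqP; split.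
have [jn|nj] := leqP j n; last first.
  rewrite (_ : mkset _ = setT) //; apply/seteqP; split => // e _ /=.
  exact: leq_trans (ltn_ord _) nj.
rewrite (_ : mkset _ = [set e | 2 * barPhi `|theta 0 i + e| <= gbs_crit n alpha j]).
  exact: measurable_pval_le.
by apply/seteqP; split => e /=; rewrite /cell_obs cell_lt // j0.
Qed.

Lemma measurable_cell_obs i v : measurable (cell_obs i @^-1` [set v]).
Proof.
rewrite (_ : _ @^-1` _ = [set e | (cell_obs i e < v.+1)%N] `\`
    [set e | (cell_obs i e < v)%N]).
  by apply: measurableD; exact: measurable_cell_lt.
apply/seteqP; split => e /=; first by move=> ->; rewrite ltnSn ltnn.
by move=> [H1 /negP H2]; apply/val_inj/eqP; rewrite /= eqn_leq -ltnS H1 leqNgt.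
Qed.

Definition cell_law (i : 'I_n) (v : 'I_n.+1) : R := gauss (cell_obs i @^-1` [set v]).

Lemma cell_law_ge0 i v : 0 <= cell_law i v. Proof. exact: gauss_ge0. Qed.

(** Additivity of the measure over the finitely many cells. *)
Lemma cell_law_sum i (Q : pred 'I_n.+1) :
  \sum_(v | Q v) cell_law i v = gauss [set e | Q (cell_obs i e)].
Proof.
have mQ : measurable [set e | Q (cell_obs i e)].
  rewrite (_ : mkset _ = \big[setU/set0]_(v <- [seq v <- enum 'I_n.+1 | Q v])
      (cell_obs i @^-1` [set v])).
    by apply: bigsetU_measurable => v _; exact: measurable_cell_obs.
  rewrite -bigcup_seq; apply/seteqP; split => e /=.
    by move=> Qe; exists (cell_obs i e) => //=; rewrite mem_filter Qe mem_enum.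
  by move=> [v /=]; rewrite mem_filter => /andP[Qv _] ->.
apply: EFin_inj; rewrite -gaussE //.
have := @integral_finite_valued R _ _ (@normal_prob R 0 1) _ (cell_obs i)
  (fun v => (Q v)%:R) (measurable_cell_obs i) (fun v => ler0n _ _).
have -> : (\int[normal_prob 0 1]_t ((Q (cell_obs i t))%:R)%:E)%E =
    normal_prob 0 1 [set e | Q (cell_obs i e)] :> \bar R.
  rewrite -[in RHS](setIT [set e | Q (cell_obs i e)]) -integral_indic //.
  apply: eq_integral => e _.
  rewrite indicE; case: (boolP (Q _)) => Qe; first by rewrite mem_set.
  by rewrite memNset //; exact/negP.
move=> ->; rewrite -sumEFin big_mkcond /=; apply: eq_bigr => v _.
rewrite gaussE; last exact: measurable_cell_obs.
by case: (Q v); rewrite ?mul1e ?mul0e.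
Qed.

Lemma cell_law_sum1 i : \sum_v cell_law i v = 1.
Proof.
rewrite cell_law_sum /gauss (_ : mkset _ = setT); last by apply/seteqP; split.
by rewrite probability_setT.
Qed.

Lemma cell_law_lt i (j : nat) : (0 < j <= n)%N ->
  \sum_(v : 'I_n.+1 | (v < j)%N) cell_law i v =
  gauss [set e | 2 * barPhi `|theta 0 i + e| <= gbs_crit n alpha j].
Proof.
move=> jn; rewrite (cell_law_sum i (fun v => v < j)%N); congr gauss.
by apply/seteqP; split => e /=; rewrite /cell_obs cell_lt.
Qed.

Lemma cell_law_ge i (j : nat) : (0 < j <= n)%N ->
  \sum_(v : 'I_n.+1 | (j <= v)%N) cell_law i v =
  gauss [set e | gbs_crit n alpha j < 2 * barPhi `|theta 0 i + e|].
Proof.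
move=> jn; rewrite (cell_law_sum i (fun v => j <= v)%N); congr gauss.
by apply/seteqP; split => e /=; rewrite leqNgt /cell_obs cell_lt // -ltNge.
Qed.

(** The event that the cells equal [z] is an intersection of events on the single
    coordinates, so the product rule for rectangles is all that is needed. *)
Lemma expectation_cells (d : measure_display) (Omega : measurableType d)
    (P : probability Omega R) (eps : 'I_n -> {RV P >-> R})
    (h : {ffun 'I_n -> 'I_n.+1} -> R) :
  iid_std_normal eps -> (forall z, 0 <= h z) ->
  ('E_P[fun om => h (cells alpha (\row_i (theta 0 i + eps i om))%R)] =
   (pexp cell_law h)%:E)%E.
Proof.
move=> [indep law] h0; rewrite unlock.
pose c om := cells alpha (\row_i (theta 0 i + eps i om)).
have cE om i : c om i = cell_obs i (eps i om).
  by rewrite /c ffunE /cell_obs /pval mxE.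
have cz z : c @^-1` [set z] =
    \bigcap_(i in [set` [set: 'I_n]%SET]) (eps i @^-1` (cell_obs i @^-1` [set z i])).
  apply/seteqP; split => om /=; first by move=> <- i _ /=; rewrite cE.
  by move=> H; apply/ffunP => i; rewrite cE; apply: H => /=; rewrite inE.
have mc z : measurable (c @^-1` [set z]).
  rewrite cz; apply: fin_bigcap_measurable => // i _.
  rewrite -[X in measurable X]setTI; apply: measurable_funPT => //.
  exact: measurable_cell_obs.
rewrite (integral_finite_valued P mc h0) /pexp -sumEFin; apply: eq_bigr => z _.
rewrite mulrC EFinM; congr (_ * _)%E.
have mB i : measurable (cell_obs i @^-1` [set z i]) by exact: measurable_cell_obs.
have /= E := indep [set: 'I_n]%SET (fun i => cell_obs i @^-1` [set z i]) mB.
rewrite cz E.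
rewrite /pweight -prodEFin; under eq_bigl do rewrite inE.
apply: eq_bigr => i _; rewrite /cell_law -gaussE; last exact: measurable_cell_obs.
by rewrite -(law i) //; exact: measurable_cell_obs.
Qed.

End CellLaw.

(** * Thresholds and power near [astar] *)

Section Threshold.
Variable R : realType.

(** The threshold [astar + y] is [sqrt (2 log (4n / (j alpha)))], for which the
    tail bound [exp (- x^2/2)] equals [j alpha / (4n)]; this is below [c_j / 2]
    because the denominator of [c_j] is at most [n + 1 <= 2n].  The last
    identity comes from expanding the square of [astar + y]. *)
Lemma detection_threshold (n s j : nat) (alpha : R) :
  (0 < s <= n)%N -> (0 < j <= s)%N -> 0 < alpha < 1 ->
  exists y, [/\ 0 <= y,
    barPhi (astar n s + y) <= gbs_crit n alpha j / 2 &
    expR (- (y ^+ 2 / 2 + astar n s * y)) = j%:R / s%:R * alpha / 4].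
Proof.
move=> /andP[s0 sn] /andP[j0 js] /andP[a0 a1].
have n0 : (0 < n)%N := leq_trans s0 sn.
have s0' : 0 < s%:R :> R by rewrite ltr0n.
have j0' : 0 < j%:R :> R by rewrite ltr0n.
have n0' : 0 < n%:R :> R by rewrite ltr0n.
have n1 : 1 <= n%:R :> R by rewrite ler1n.
have js' : j%:R <= s%:R :> R by rewrite ler_nat.
have sn' : s%:R <= n%:R :> R by rewrite ler_nat.
pose q : R := n%:R / s%:R; pose p : R := 4 * n%:R / (j%:R * alpha).
have ja0 : 0 < j%:R * alpha by rewrite mulr_gt0.
have q1 : 1 <= q by rewrite /q ler_pdivlMr // mul1r.
have p0 : 0 < p by rewrite divr_gt0 // mulr_gt0.
have ja : j%:R * alpha <= s%:R.
  by rewrite -[leRHS]mulr1 ler_pM // ltW.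
have qp : q <= p.
  rewrite /q /p ler_pdivrMr // mulrAC ler_pdivlMr //.
  have : n%:R * (j%:R * alpha) <= n%:R * s%:R by rewrite ler_wpM2l // ltW.
  have : 0 <= n%:R * s%:R :> R by rewrite mulr_ge0.
  lra.
have lq0 : 0 <= ln q by rewrite ln_ge0.
have lqp : ln q <= ln p by rewrite ler_ln // posrE // (lt_le_trans ltr01).
have A2 : astar n s ^+ 2 = 2 * ln q by rewrite sqr_sqrtr // mulr_ge0.
pose x := Num.sqrt (2 * ln p).
have x2 : x ^+ 2 = 2 * ln p by rewrite sqr_sqrtr // mulr_ge0 // (le_trans lq0).
have Ax : astar n s <= x.
  by rewrite /astar /x ler_wsqrtr // ler_wpM2l.
exists (x - astar n s); rewrite subr_ge0; split => //.
  rewrite addrC subrK; apply: (le_trans (barPhi_tail _)); first exact: sqrtr_ge0.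
  rewrite x2 mulrAC divff // mul1r expRN lnK ?posrE // /p invf_div.
  rewrite /gbs_crit -mulrA -invfM ler_wpM2l //; first exact: ltW.
  have d0 := @gbs_denom_gt0 R n alpha _ j; rewrite a0 a1 in d0.
  have {}d0 := d0 isT (leq_trans js sn).
  rewrite lef_pV2 ?posrE ?mulr_gt0 //.
  have : 0 <= j%:R * (1 - alpha) by rewrite mulr_ge0 // subr_ge0 ltW.
  lra.
have -> : - ((x - astar n s) ^+ 2 / 2 + astar n s * (x - astar n s)) =
    (astar n s ^+ 2 - x ^+ 2) / 2 by field.
rewrite A2 x2 -mulrBr mulrAC divff // mul1r expRD expRN !lnK ?posrE //; last first.
  exact: lt_le_trans q1.
rewrite /q /p invf_div; field.
by rewrite !gt_eqF.
Qed.

(** A lower bound for [barPhi (K + 1)], and for the normal density at [K + 1]. *)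
Definition power_const (K : R) : R := normal_peak 1 * expR (- ((K + 2) ^+ 2 / 2)).

Lemma power_const_gt0 K : 0 < power_const K.
Proof. by rewrite mulr_gt0 ?expR_gt0 // normal_peak_gt0 // oner_neq0. Qed.

(** Power at the threshold [A + y] of a signal of strength [A - K], compared with
    [u = j/s].  For [y <= 1] the power is bounded below while [u] is small.  For
    [y > 1], completing the square shows that the density at distance [y + K + 1]
    is [u alpha / 4] times [exp ((A - K - 1) y)], up to a constant; that
    exponential is at least [exp (A/2)], which beats [1/alpha <= exp (A/4)]. *)
Lemma detection_power (K A y u alpha D : R) :
  0 <= K -> 0 <= y -> 0 < u -> 2 * (K + 1) <= A ->
  expR (- (y ^+ 2 / 2 + A * y)) = u * alpha / 4 ->
  expR (- (A / 4)) <= alpha ->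
  4 * D <= A -> D * u <= 1 -> 0 < D ->
  power_const K * (D * u) <= 4 * barPhi (y + K).
Proof.
move=> K0 y0 u0 KA yE alA DA Du D0.
have c0 := power_const_gt0 K.
have [y1|y1] := leP y 1.
  have H : power_const K <= barPhi (y + K).
    apply: (@le_trans _ _ (barPhi (1 + K))); last by apply: barPhi_anti; lra.
    apply: le_trans (barPhi_lower _); last lra.
    by rewrite /power_const (_ : 1 + K + 1 = K + 2) //; lra.
  have : power_const K * (D * u) <= power_const K * 1 by rewrite ler_pM2l.
  lra.
have yK : 0 <= y + K by rewrite addr_ge0.
have := barPhi_lower yK.
set b := barPhi _.
have -> : - ((y + K + 1) ^+ 2 / 2) =
    - (y ^+ 2 / 2 + A * y) + (A - (K + 1)) * y - (K + 1) ^+ 2 / 2 by field.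
rewrite 2!expRD yE => H.
have H1 : expR (A / 4) <= alpha * expR ((A - (K + 1)) * y).
  apply: (@le_trans _ _ (expR (- (A / 4)) * expR ((A - (K + 1)) * y))).
    rewrite -expRD ler_expR.
    have : (A - (K + 1)) * 1 <= (A - (K + 1)) * y by rewrite ler_wpM2l; lra.
    lra.
  by rewrite ler_pM2r ?expR_gt0.
have H2 : D <= alpha * expR ((A - (K + 1)) * y).
  apply: le_trans H1; apply: le_trans (expR_ge1Dx _); lra.
have H3 : power_const K <= normal_peak 1 * expR (- ((K + 1) ^+ 2 / 2)).
  rewrite ler_wpM2l ?normal_peak_ge0 // ler_expR lerN2 ler_pM2r //.
  by rewrite ler_pXn2r // ?nnegrE; lra.
have {}H : u * ((alpha * expR ((A - (K + 1)) * y)) *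
    (normal_peak 1 * expR (- ((K + 1) ^+ 2 / 2)))) <= 4 * b.
  by apply: le_trans (ler_wpM2l _ H); rewrite // le_eqVlt; apply/orP; left; apply/eqP; field.
apply: le_trans H; rewrite mulrA mulrC ler_pM2l // mulrC.
by apply: ler_pM => //; exact: ltW.
Qed.

End Threshold.

(** * Expected errors at a fixed parameter *)

Section RiskBound.
Variable R : realType.

Lemma astar_ge0 (n s : nat) : 0 <= astar n s :> R.
Proof. exact: sqrtr_ge0. Qed.

Lemma Lambda_ge0 (n s : nat) (a : 'rV[R]_s) : 0 <= Lambda n a.
Proof.
by rewrite mulr_ge0 ?invr_ge0 // sumr_ge0 // => j _; exact: barPhi_ge0.
Qed.

Lemma sum_supp (n s : nat) (theta : 'rV[R]_n) (i : 'I_s -> 'I_n) (f : 'I_n -> R) :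
  #|supp theta| = s -> injective i -> (forall j, i j \in supp theta) ->
  \sum_(k in ~: nulls theta) f k = \sum_j f (i j).
Proof.
move=> cs inj_i signal_supp.
have -> : ~: nulls theta = [set i j | j : 'I_s]%SET.
  apply/eqP; rewrite eq_sym eqEcard card_imset // card_ord -[X in (_ <= X)%N]cs.
  apply/andP; split.
    by apply/fintype.subsetP => _ /imsetP[j _ ->]; have := signal_supp j; rewrite !inE.
  by apply/subset_leq_card/fintype.subsetP => k; rewrite !inE.
rewrite big_imset /=; last by move=> j k _ _; exact: inj_i.
by apply: eq_bigl => j; rewrite inE.
Qed.

Section Fixed.
Variables (n s : nat) (alpha : R) (a : 'rV[R]_s) (theta : 'rV[R]_n).
Hypothesis sn : (0 < s <= n)%N.
Hypothesis alpha01 : 0 < alpha < 1.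
Hypothesis a_gt0 : forall j, 0 < a 0 j.
Hypothesis card_supp : #|supp theta| = s.
Variable i_ : 'I_s -> 'I_n.
Hypothesis inj_i : injective i_.
Hypothesis a_le : forall j, a 0 j <= `|theta 0 (i_ j)|.

Let w := cell_law alpha theta.

Let w0 i v : 0 <= w i v. Proof. exact: cell_law_ge0. Qed.
Let w1 i : \sum_v w i v = 1. Proof. exact: cell_law_sum1. Qed.

Lemma signal_supp j : i_ j \in supp theta.
Proof. by rewrite inE -normr_gt0 (lt_le_trans (a_gt0 j)). Qed.

Lemma card_nonnulls : #|~: nulls theta| = s.
Proof. by rewrite -card_supp; apply: eq_card => i; rewrite !inE. Qed.

Lemma expected_V_le : (1 - alpha) * pexp w (fun z => (nrejected (nulls theta) z)%:R) <=
  alpha * s.+1%:R.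
Proof.
rewrite -[in leRHS]card_nonnulls; apply: expected_false_rejections => //.
move=> i; rewrite inE => /eqP ti k kn.
have /= E := @cell_law_lt R n alpha alpha01 theta i k.+1 kn.
rewrite [leLHS](E : _ = _).
rewrite ti (_ : mkset _ = [set e | 2 * barPhi `|e| <= gbs_crit n alpha k.+1]); last first.
  by apply/seteqP; split => e /=; rewrite add0r.
apply: null_superuniform; rewrite divr_gt0 //.
  by case/andP: alpha01 => ? _; rewrite mulr_gt0.
exact: gbs_denom_gt0.
Qed.

Lemma miss_prob_le i (j : nat) (x : R) : (0 < j <= n)%N ->
  barPhi x <= gbs_crit n alpha j / 2 ->
  \sum_(v : 'I_n.+1 | (j <= v)%N) w i v <= barPhi (`|theta 0 i| - x).
Proof. by move=> jn xj; rewrite cell_law_ge //; exact: accept_prob_le. Qed.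

Lemma detect_prob_ge i (j : nat) (x : R) : (0 < j <= n)%N ->
  barPhi x <= gbs_crit n alpha j / 2 ->
  barPhi (x - `|theta 0 i|) <= \sum_(v : 'I_n.+1 | (v < j)%N) w i v.
Proof.
move=> jn xj; have := miss_prob_le i jn xj.
have := w1 i; rewrite (bigID (fun v : 'I_n.+1 => v < j)%N) /=.
have -> : \sum_(v : 'I_n.+1 | ~~ (v < j)%N) w i v =
    \sum_(v : 'I_n.+1 | (j <= v)%N) w i v by apply: eq_bigl => v; rewrite -leqNgt.
by rewrite -[x - _]opprB barPhiN; lra.
Qed.

Lemma expected_T_le_card :
  pexp w (fun z => #|[set i in ~: nulls theta | (stepdown z < z i)%N]|%:R) <= s%:R.
Proof.
rewrite -[leRHS](pexp_cst w1); apply: pexp_le => // z.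
rewrite ler_nat -[leqRHS]card_nonnulls; apply/subset_leq_card/fintype.subsetP => i.
by rewrite !inE => /andP[].
Qed.

Variables (delta K D : R).
Hypothesis delta01 : 0 < delta <= 1.
Hypothesis K0 : 0 <= K.
Hypothesis K_tail : barPhi K <= delta / 2.
Hypothesis DE : D * (delta * power_const K) = 8 * (2 + 2 / delta).
Hypothesis D1 : 1 <= D.
Let A : R := astar n s.
Hypothesis AK : 2 * (K + 1) <= A.
Hypothesis AD : 4 * D <= A.
Hypothesis A_delta : expR (- (delta * A / 2)) <= (8 * D)^-1.
Hypothesis alpha_ge : expR (- (delta * A / 4)) <= alpha.
Hypothesis s_large : 2 * D <= s%:R.
Hypothesis Lambda_le : Lambda n a <= 1 - delta.

Let G : {set 'I_n} := [set i_ j | j : 'I_s & A - K <= a 0 j]%SET.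

(** Weak signals contribute at most [delta/2] each to the average of
    [1 - barPhi (a_j - A)], which is at least [delta]. *)
Lemma card_strong : delta / 2 * s%:R <= #|G|%:R.
Proof.
have s0 : 0 < s%:R :> R by rewrite ltr0n; case/andP: sn.
have : delta * s%:R <= \sum_(j < s) (1 - barPhi (a 0 j - A)).
  move: Lambda_le; rewrite /Lambda -/A mulrC ler_pdivrMr //.
  rewrite [in X in _ -> X](sumrB _ _ (fun=> 1) (fun j => barPhi (a 0 j - A))).
  rewrite sumr_const card_ord; lra.
have -> : #|G|%:R = \sum_(j < s) (if A - K <= a 0 j then 1 else 0) :> R.
  rewrite card_imset // -sum1_card natr_sum big_mkcond /=.
  by apply: eq_bigr => j _; rewrite inE; case: ifP.
have H j : 1 - barPhi (a 0 j - A) <= (if A - K <= a 0 j then 1 else 0) + delta / 2.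
  have /andP[d0 d1] := delta01.
  case: (leP (A - K) (a 0 j)) => /= H; first by have := barPhi_ge0 (a 0 j - A); lra.
  have : barPhi (- K) <= barPhi (a 0 j - A) by apply: barPhi_anti; lra.
  by have := K_tail; rewrite barPhiN; lra.
move=> HL; have : \sum_(j < s) (1 - barPhi (a 0 j - A)) <=
    \sum_(j < s) ((if A - K <= a 0 j then 1 else 0) + delta / 2).
  by apply: ler_sum => j _; exact: H.
rewrite [leRHS]big_split /= [X in _ + X]sumr_const card_ord -[_ *+ s]mulr_natr; lra.
Qed.

(** The constant [D] is chosen so that the power bound gives at least
    [(2 + 2/delta) j] expected strong detections at level [c_j]. *)
Lemma stop_early_prob (k : nat) : (k <= s)%N -> D * k%:R <= s%:R ->
  pexp w (fun z => (stepdown z < k)%N%:R) <= delta.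
Proof.
move=> ks Dk; have /andP[d0 d1] := delta01.
have /andP[s0 sn'] := sn.
have s0' : 0 < s%:R :> R by rewrite ltr0n.
pose yP j := fun y : R => [/\ 0 <= y,
    barPhi (A + y) <= gbs_crit n alpha j / 2 &
    expR (- (y ^+ 2 / 2 + A * y)) = j%:R / s%:R * alpha / 4].
have yex j : exists y, (0 < j <= s)%N -> yP j y.
  case: (boolP (0 < j <= s)%N) => js; last by exists 0.
  by have [y Hy] := detection_threshold sn js alpha01; exists y.
have [y Hy] := choice yex.
rewrite -[leRHS]invrK.
apply: (@early_stop_le R n w w0 w1 G delta^-1 (fun j => barPhi (y j + K))).
- by rewrite invr_gt0.
- exact: leq_trans ks sn'.
- move=> j /andP[j0 jk] i /imsetP[l]; rewrite inE => Gl ->.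
  have js : (0 < j <= s)%N by rewrite j0 (leq_trans jk).
  have [_ H _] := Hy j js.
  have jn : (0 < j <= n)%N by rewrite j0 (leq_trans jk) // (leq_trans ks).
  apply: le_trans (detect_prob_ge _ jn H); apply: barPhi_anti.
  by have := a_le l; lra.
- move=> j /andP[j0 jk].
  have js : (0 < j <= s)%N by rewrite j0 (leq_trans jk).
  have [y0 _ yE] := Hy j js.
  have j0' : 0 < j%:R :> R by rewrite ltr0n.
  have u0 : 0 < j%:R / s%:R :> R by rewrite divr_gt0.
  have Du : D * (j%:R / s%:R) <= 1.
    rewrite mulrA ler_pdivrMr // mul1r (le_trans _ Dk) // ler_wpM2l ?ler_nat //.
    exact: le_trans D1.
  have al : expR (- (A / 4)) <= alpha.
    apply: le_trans alpha_ge; rewrite ler_expR lerN2.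
    have : delta * A <= 1 * A by rewrite ler_wpM2r // astar_ge0.
    lra.
  have D0 : 0 < D by exact: lt_le_trans D1.
  have := detection_power K0 y0 u0 AK yE al AD Du D0.
  set b := barPhi _ => H.
  have b0 : 0 <= b by exact: barPhi_ge0.
  have : delta / 2 * s%:R * b <= #|G|%:R * b by rewrite ler_wpM2r // card_strong.
  apply: le_trans.
  have {}H : D * (delta * power_const K) * (j%:R / s%:R) <= 4 * b * delta.
    apply: le_trans (_ : (power_const K * (D * (j%:R / s%:R))) * delta <= _).
      by rewrite le_eqVlt; apply/orP; left; apply/eqP; ring.
    by rewrite ler_wpM2r // ltW.
  rewrite DE mulrA ler_pdivrMr // in H.
  lra.
Qed.

(** With probability at least [1 - delta] at least [k] hypotheses are rejected,
    where [k] is about [s / (2 D)], and the threshold of [c_k] exceeds [A] by at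
    most [delta]. *)
Lemma expected_T_le :
  pexp w (fun z => #|[set i in ~: nulls theta | (stepdown z < z i)%N]|%:R) <=
  s%:R * (Lambda n a + 2 * delta).
Proof.
have /andP[d0 d1] := delta01; have /andP[s0 sn'] := sn.
have s0' : 0 < s%:R :> R by rewrite ltr0n.
have D0 : 0 < D by exact: lt_le_trans D1.
have A0 : 0 < A by apply: lt_le_trans AD; rewrite mulr_gt0.
(* [k] lies between [s / (2 D)] and [s / D]: large enough for the threshold of
   [c_k] to be close to [A], small enough for the union bound. *)
pose k := (Num.truncn (s%:R / (2 * D))).+1.
have q0 : 0 <= s%:R / (2 * D) by rewrite divr_ge0 // ltW // mulr_gt0.
have q1 : 1 <= s%:R / (2 * D) by rewrite ler_pdivlMr ?mulr_gt0 // mul1r.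
have kq : s%:R / (2 * D) <= k%:R by rewrite ltW // truncnS_gt.
have qk : k%:R <= s%:R / D.
  rewrite /k -natr1; have := truncn_le (s%:R / (2 * D)); rewrite q0 => tq.
  have -> : s%:R / D = 2 * (s%:R / (2 * D)) by field; rewrite gt_eqF.
  lra.
have Dk : D * k%:R <= s%:R by rewrite mulrC -ler_pdivlMr.
have ks : (k <= s)%N.
  rewrite -(ler_nat R); apply: le_trans qk _; rewrite ler_pdivrMr //.
  by rewrite ler_peMr // ltW.
have k0 : (0 < k <= s)%N by [].
have kn : (0 < k <= n)%N by rewrite /= (leq_trans ks).
have [y [y0 xk yE]] := detection_threshold sn k0 alpha01.
apply: (le_trans (expected_missed w0 w1 _ k)).
rewrite card_nonnulls.
have H1 := stop_early_prob ks Dk.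
have H2 : \sum_(i in ~: nulls theta) \sum_(v : 'I_n.+1 | (k <= v)%N) w i v <=
    \sum_(j < s) (barPhi (a 0 j - A) + y).
  rewrite (sum_supp _ card_supp inj_i signal_supp); apply: ler_sum => j _.
  apply: (le_trans (miss_prob_le _ kn xk)).
  apply: (@le_trans _ _ (barPhi (a 0 j - (A + y)))).
    by apply: barPhi_anti; rewrite lerD2r a_le.
  rewrite opprD addrA.
  have := @barPhi_lipschitz R (a 0 j - A - y) (a 0 j - A).
  have -> : a 0 j - A - y <= a 0 j - A by lra.
  by move=> /(_ isT); lra.
have y_small : y <= delta.
  have : expR (- (delta * A)) <= expR (- (y ^+ 2 / 2 + A * y)).
    rewrite -/A in yE; rewrite yE.
    have H3 : expR (- (delta * A / 2)) * expR (- (delta * A / 4)) <= (8 * D)^-1 * alpha.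
      by apply: ler_pM; rewrite ?expR_ge0.
    have H4 : expR (- (delta * A)) <= expR (- (delta * A / 2)) * expR (- (delta * A / 4)).
      rewrite -expRD ler_expR.
      have : 0 <= delta * A by rewrite mulr_ge0 // ltW.
      lra.
    apply: (le_trans H4); apply: (le_trans H3).
    have kq' : (2 * D)^-1 <= k%:R / s%:R.
      by rewrite ler_pdivlMr // mulrC.
    have al0 : 0 <= alpha by case/andP: alpha01 => /ltW.
    have := ler_wpM2r al0 kq'.
    have -> : (8 * D)^-1 = (2 * D)^-1 / 4 by field; rewrite gt_eqF.
    lra.
  rewrite ler_expR lerN2 => H3.
  have y2 : 0 <= y ^+ 2 by rewrite sqr_ge0.
  rewrite -(ler_pM2l A0); lra.
have H5 : s%:R * pexp w (fun z => (stepdown z < k)%N%:R) <= s%:R * delta.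
  by rewrite ler_pM2l.
have H6 : s%:R * y <= s%:R * delta by rewrite ler_pM2l.
have : \sum_(j < s) (barPhi (a 0 j - A) + y) = s%:R * Lambda n a + s%:R * y.
  rewrite big_split /= sumr_const card_ord -[_ *+ s]mulr_natl; congr (_ + _).
  by rewrite /Lambda mulVKf // gt_eqF.
lra.
Qed.

End Fixed.
End RiskBound.

(** * Risk bounds *)

Section Risk.
Variable R : realType.

Lemma riskE (d : measure_display) (Omega : measurableType d)
    (P : probability Omega R) (n s : nat) (eps : 'I_n -> {RV P >-> R})
    (alpha : R) (theta : 'rV[R]_n) :
  0 < alpha < 1 -> iid_std_normal eps ->
  risk eps s (gbs alpha) theta =
  (s%:R^-1 * (pexp (cell_law alpha theta) (fun z => (nrejected (nulls theta) z)%:R) +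
    pexp (cell_law alpha theta)
      (fun z => #|[set i in ~: nulls theta | (stepdown z < z i)%N]%SET|%:R)))%:E.
Proof.
move=> alpha01 iid; rewrite /risk EFinM; congr (_ * _)%E.
rewrite -pexpD -(expectation_cells alpha01 theta iid); last first.
  by move=> z; rewrite addr_ge0.
congr expectation; apply/funext => om /=.
by rewrite errors_stepdown // natrD.
Qed.

(** Either [Lambda] is at most [1 - delta] and the procedure finds a positive
    fraction of the signals, or bounding the missed signals by [s] is already
    sharp enough. *)
Lemma risk_le_large (delta : R) : 0 < delta <= 1 ->
  exists A0 s0 : R, forall (d : measure_display) (Omega : measurableType d)
    (P : probability Omega R) (n s : nat) (eps : 'I_n -> {RV P >-> R})
    (alpha : R) (a : 'rV[R]_s) (theta : 'rV[R]_n),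
  iid_std_normal eps -> (0 < s <= n)%N -> 0 < alpha < 1 ->
  (forall j, 0 < a 0 j) -> Theta n a theta ->
  A0 <= astar n s -> s0 <= s%:R -> alpha <= delta / 4 ->
  expR (- (delta * astar n s / 4)) <= alpha ->
  (risk eps s (gbs alpha) theta <= (Lambda n a + 3 * delta)%:E)%E.
Proof.
move=> delta01; have /andP[d0 d1] := delta01.
have [|K K0 KT] := @barPhi_small R (delta / 2); first by rewrite divr_gt0.
have c0 := power_const_gt0 K.
have dc0 : 0 < delta * power_const K by rewrite mulr_gt0.
pose D := 8 * (2 + 2 / delta) / (delta * power_const K).
have DE : D * (delta * power_const K) = 8 * (2 + 2 / delta).
  by rewrite /D divfK // gt_eqF.
have id0 : 0 < 2 / delta by rewrite divr_gt0.
have D1 : 1 <= D.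
  rewrite /D ler_pdivlMr // mul1r.
  have : power_const K <= 1.
    rewrite /power_const -[leRHS]mulr1; apply: ler_pM; rewrite ?normal_peak_ge0 ?expR_ge0 //.
      exact: normal_peak1_le1.
    by rewrite -[leRHS]expR0 ler_expR oppr_le0 divr_ge0 // sqr_ge0.
  move=> c1; have : delta * power_const K <= 1 * 1.
    by apply: ler_pM => //; exact: ltW.
  lra.
have D0 : 0 < D by exact: lt_le_trans D1.
clearbody D.
(* The last summand makes [exp (- delta A / 2)] at most [1 / (8 D)]. *)
pose A0 := 2 * (K + 1) + 4 * D + 2 / delta * (8 * D).
exists A0, (2 * D) => d Omega P n s eps alpha a theta iid sn alpha01 a_gt0.
move=> [cs [i_ inj_i a_le]] AA0 s_large alpha_le alpha_ge.
have idD : 0 <= 2 / delta * (8 * D) by rewrite mulr_ge0 ?ltW // mulr_gt0.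
have AK : 2 * (K + 1) <= astar n s by rewrite /A0 in AA0; lra.
have AD : 4 * D <= astar n s by rewrite /A0 in AA0; lra.
have A_delta : expR (- (delta * astar n s / 2)) <= (8 * D)^-1.
  rewrite expRN lef_pV2 ?posrE ?expR_gt0 ?mulr_gt0 //.
  apply: le_trans (expR_ge1Dx _).
  have : delta / 2 * (2 / delta * (8 * D)) <= delta / 2 * astar n s.
    by rewrite ler_wpM2l ?divr_ge0 ?ltW //; rewrite /A0 in AA0; lra.
  have -> : delta / 2 * (2 / delta * (8 * D)) = 8 * D by field; rewrite gt_eqF.
  lra.
have /andP[s0 _] := sn; have s0' : 0 < s%:R :> R by rewrite ltr0n.
rewrite riskE // lee_fin mulrC ler_pdivrMr //.
have HV := expected_V_le alpha01 cs.
have HV' : pexp (cell_law alpha theta) (fun z => (nrejected (nulls theta) z)%:R) <= s%:R * delta.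
  move: HV; set v := pexp _ _ => HV.
  have v0 : 0 <= v.
    by apply: sumr_ge0 => z _; rewrite mulr_ge0 // pweight_ge0 // => i u; exact: cell_law_ge0.
  have H1 : (1 / 2) * v <= (1 - alpha) * v by rewrite ler_wpM2r //; lra.
  have s1 : s.+1%:R <= 2 * s%:R :> R by rewrite -natrM ler_nat mul2n -addnn -addn1 leq_add2l.
  have H2 : alpha * s.+1%:R <= delta / 4 * (2 * s%:R).
    by apply: ler_pM => //; case/andP: alpha01 => /ltW.
  lra.
have [HL|HL] := leP (Lambda n a) (1 - delta).
  have := expected_T_le sn alpha01 a_gt0 cs inj_i a_le delta01 K0 KT DE D1 AK AD
    A_delta alpha_ge s_large HL.
  lra.
have HT := expected_T_le_card alpha01 cs.
have sd0 : 0 <= s%:R * delta by rewrite mulr_ge0 // ltW.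
have : s%:R * (1 - delta) <= s%:R * Lambda n a by rewrite ler_pM2l // ltW.
lra.
Qed.

(** This only serves to make the supremum of the risk finite for every [n]. *)
Lemma risk_le_crude (d : measure_display) (Omega : measurableType d)
    (P : probability Omega R) (n s : nat) (eps : 'I_n -> {RV P >-> R})
    (alpha : R) (theta : 'rV[R]_n) :
  iid_std_normal eps -> 0 < alpha < 1 ->
  (risk eps s (gbs alpha) theta <= (s%:R^-1 * (n + n)%:R)%:E)%E.
Proof.
move=> iid alpha01; rewrite riskE // lee_fin ler_wpM2l ?invr_ge0 //.
have w0 := @cell_law_ge0 R n alpha theta; have w1 := @cell_law_sum1 R n alpha alpha01 theta.
rewrite -pexpD -[leRHS](pexp_cst w1); apply: pexp_le => // z.
by rewrite natrD lerD // ler_nat -[leqRHS]card_ord max_card.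
Qed.

End Risk.

Theorem theorem3 (R : realType)
  (d : nat -> measure_display) (Omega : forall n, measurableType (d n))
  (P : forall n, probability (Omega n) R)
  (eps : forall n, 'I_n -> {RV (P n) >-> R})
  (s : nat -> nat) (alpha : nat -> R) (a : forall n, 'rV[R]_(s n))
  (heps : forall n, (0 < n)%N -> iid_std_normal (eps n))
  (hs : forall n, (0 < n)%N -> (0 < s n <= n)%N)
  (halpha : forall n, (0 < n)%N -> 0 < alpha n < 1)
  (ha : forall n, (0 < n)%N -> forall j, 0 < a n 0 j)
  (s_infty : s @ \oo --> \oo)
  (ns_infty : n%:R / (s n)%:R @[n --> \oo] --> (+oo : set_system R))
  (alpha_0 : alpha @ \oo --> (0 : R))
  (log_alpha : (fun n => ln (1 / alpha n)) =o_\oo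
               (fun n => Num.sqrt (ln (n%:R / (s n)%:R)))) :
  exists2 o1 : nat -> R, o1 @ \oo --> (0 : R) &
    forall n, (0 < n)%N ->
      (ereal_sup [set risk (eps n) (s n) (gbs (alpha n)) theta
                 | theta in Theta n (a n)]
       <= (Lambda n (a n) + o1 n)%:E)%E.
Proof.
pose rset n := [set risk (eps n) (s n) (gbs (alpha n)) theta | theta in Theta n (a n)].
(* [fine] sends the infinite values of the supremum to 0; the crude bound excludes
   [+oo], and [-oo] occurs only for an empty parameter set. *)
pose o1 n : R := Num.max 0 (fine (ereal_sup (rset n)) - Lambda n (a n)).
have sup_fin n : (0 < n)%N -> (ereal_sup (rset n) <= ((s n)%:R^-1 * (n + n)%:R)%:E)%E.
  move=> n0; apply: ge_ereal_sup => _ [theta _ <-].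
  by apply: risk_le_crude; [exact: heps|exact: halpha].
exists o1; last first.
  move=> n n0; have := sup_fin n n0; rewrite -/(rset n) /o1.
  case: (ereal_sup (rset n)) => [r _| |_] //=; last by rewrite leNye.
  by rewrite lee_fin -lerBlDl le_max lexx orbT.
have key (delta : R) : 0 < delta <= 1 -> \forall n \near \oo, o1 n <= 3 * delta.
  move=> delta01; have [A0 [s0 H]] := risk_le_large delta01.
  have /andP[d0 d1] := delta01.
  have ev_s : \forall n \near \oo, s0 <= (s n)%:R :> R.
    have Hs : \forall m \near \oo, s0 <= m%:R :> R by exact: nbhs_infty_ger.
    exact: s_infty Hs.
  have ev_ratio (M : R) : \forall n \near \oo, M <= n%:R / (s n)%:R.
    by have /cvgryPge := ns_infty; apply.
  have ev_A : \forall n \near \oo, A0 <= astar n (s n) :> R.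
    near=> n.
    have H1 : expR (A0 ^+ 2 / 2) <= n%:R / (s n)%:R by near: n; exact: ev_ratio.
    have r0 : 0 < n%:R / (s n)%:R :> R by apply: lt_le_trans H1; exact: expR_gt0.
    have H2 : A0 ^+ 2 / 2 <= ln (n%:R / (s n)%:R).
      by rewrite -[leLHS]expRK ler_ln ?posrE // expR_gt0.
    apply: le_trans (ler_norm _) _; rewrite -sqrtr_sqr ler_wsqrtr //; lra.
  have ev_al : \forall n \near \oo, alpha n <= delta / 4.
    by apply: (cvgr_le _ alpha_0); rewrite divr_gt0.
  have ev_log : \forall n \near \oo, expR (- (delta * astar n (s n) / 4)) <= alpha n.
    have d4 : 0 < delta / 4 by rewrite divr_gt0.
    have /eqoP/(_ _ d4) Ho := log_alpha.
    near=> n.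
    have n0 : (0 < n)%N by near: n; exists 1%N.
    have /andP[a0 a1] := halpha _ n0.
    have : `|ln (1 / alpha n)| <= delta / 4 * `|Num.sqrt (ln (n%:R / (s n)%:R))|.
      by near: n.
    rewrite (ger0_norm (sqrtr_ge0 _)) => /(le_trans (ler_norm _)).
    rewrite div1r lnV ?posrE // => Hl.
    have Hs : Num.sqrt (ln (n%:R / (s n)%:R)) <= astar n (s n) :> R.
      apply: ler_wsqrtr; have : 0 <= ln (n%:R / (s n)%:R) :> R.
        rewrite ln_ge0 // ler_pdivlMr ?mul1r ?ler_nat.
          by case/andP: (hs _ n0).
        by rewrite ltr0n; case/andP: (hs _ n0).
      lra.
    rewrite -[leRHS]lnK ?posrE // ler_expR lerNl.
    apply: (le_trans Hl); rewrite mulrAC ler_wpM2r // ler_wpM2l // ltW //.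
  near=> n.
  have n0 : (0 < n)%N by near: n; exists 1%N.
  rewrite /o1 ge_max; apply/andP; split; first by rewrite mulr_ge0 // ltW.
  rewrite lerBlDl.
  have : (ereal_sup (rset n) <= (Lambda n (a n) + 3 * delta)%:E)%E.
    apply: ge_ereal_sup => _ [theta Htheta <-].
    apply: H => //; [exact: heps|exact: hs|exact: halpha|exact: ha|near: n..]; done.
  case: (ereal_sup (rset n)) => [r| |] //=.
  by move=> _; rewrite addr_ge0 // ?Lambda_ge0 // mulr_ge0 // ltW.
apply/cvgrPdist_le => e e0.
pose delta := Num.min 1 (e / 3).
have delta01 : 0 < delta <= 1 by rewrite /delta lt_min ltr01 divr_gt0 //= ge_min lexx.
have de : 3 * delta <= e.
  have : delta <= e / 3 by rewrite /delta ge_min lexx orbT.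
  lra.
near=> n; rewrite sub0r normrN ger0_norm; last by rewrite /o1 le_max lexx.
by apply: le_trans de; near: n; exact: key.
Unshelve. all: by end_near.
Qed.
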